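(* Let $\mathcal F$ be a division ring with an involutive anti-automorphism $*$ and of characteristic different from $2$. Let $A\in\mathcal F^{m\times p}$, $B\in\mathcal F^{m\times q}$, $C\in\mathcal F^{s\times p}$, $D\in\mathcal F^{t\times p}$, $\Phi=\Phi^*\in\mathcal F^{m\times m}$, $\Psi=\Psi^*\in\mathcal F^{s\times s}$, $\Omega=\Omega^*\in\mathcal F^{t\times t}$. The system of matrix equations $$AXA^*+BYB^*=\Phi,\qquad CXC^*=\Psi,\qquad DXD^*=\Omega$$ has a pair of Hermitian solutions $(X,Y)\in\mathcal F^{p\times p}\times\mathcal F^{q\times q}$ (that is, a solution with $X=X^*$, $Y=Y^*$) if and only if all of the following rank equalities hold: $$\mathrm{r}\begin{pmatrix}\Phi&A\\ B^*&0\end{pmatrix}=\mathrm{r}(A)+\mathrm{r}(B),\quad \mathrm{r}(A,B,\Phi)=\mathrm{r}(A,B),$$ $$\mathrm{r}(C,\Psi)=\mathrm{r}(C),\quad \mathrm{r}(D,\Omega)=\mathrm{r}(D),\quad \mathrm{r}\begin{pmatrix}\Psi&0&C\\ 0&-\Omega&D\\ C^*&D^*&0\end{pmatrix}=2\,\mathrm{r}\begin{pmatrix}C\\ D\end{pmatrix},$$ $$\mathrm{r}\begin{pmatrix}0&0&A^*&C^*\\ A&B&-\Phi&0\\ C&0&0&\Psi\end{pmatrix}=\mathrm{r}\begin{pmatrix}A&B\\ C&0\end{pmatrix}+\mathrm{r}\begin{pmatrix}A\\ C\end{pmatrix},$$ $$\mathrm{r}\begin{pmatrix}0&0&A^*&D^*\\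 A&B&-\Phi&0\\ D&0&0&\Omega\end{pmatrix}=\mathrm{r}\begin{pmatrix}A&B\\ D&0\end{pmatrix}+\mathrm{r}\begin{pmatrix}A\\ D\end{pmatrix},$$ $$\mathrm{r}\begin{pmatrix}0&0&A^*&C^*&D^*\\ 0&0&B^*&0&0\\ A&A&-\Phi&0&0\\ C&0&0&\Psi&0\\ 0&D&0&0&\Omega\end{pmatrix}=\mathrm{r}\begin{pmatrix}A&B\\ C&0\\ D&0\end{pmatrix}+\mathrm{r}\begin{pmatrix}A&A\\ C&0\\ 0&D\end{pmatrix},$$ $$\mathrm{r}\begin{pmatrix}0&0&0&A^*&C^*&D^*\\ A&A&B&-\Phi&0&0\\ C&0&0&0&\Psi&0\\ 0&D&0&0&0&\Omega\end{pmatrix}=\mathrm{r}\begin{pmatrix}A\\ C\\ D\end{pmatrix}+\mathrm{r}\begin{pmatrix}A&A&B\\ C&0&0\\ 0&D&0\end{pmatrix},$$ $$\mathrm{r}\begin{pmatrix}0&0&0&0&0&0&B^*\\ 0&0&0&D^*&0&A^*&0\\ 0&0&0&0&C^*&A^*&A^*\\ 0&C&0&0&-\Psi&0&0\\ 0&0&D&\Omega&0&0&0\\ 0&A&A&0&0&0&\Phi\\ B&0&A&0&0&-\Phi&0\end{pmatrix}=2\,\mathrm{r}\begin{pmatrix}0&A&B\\ A&A&0\\ C&0&0\\ 0&D&0\end{pmatrix}.$$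
   Context: $\mathcal F^{m\times n}$ is the set of $m\times n$ matrices over $\mathcal F$. For a matrix $A$ over $\mathcal F$, $A^*$ is its conjugate transpose: the transpose with the involutive anti-automorphism $*$ of $\mathcal F$ applied to each entry. A square matrix $X$ is Hermitian if $X=X^*$. The rank $\mathrm{r}(\cdot)$ of a matrix over $\mathcal F$ is the dimension of its left row space, equal to the dimension of its right column space. Blocks $0$ denote zero blocks of the appropriate size. *)

(* Defs.v *)
From mathcomp Require Import all_boot all_order all_algebra.
From mathcomp Require Import boolp classical_sets.

Set Implicit Arguments.
Unset Strict Implicit.
Unset Printing Implicit Defensive.

Import GRing.Theory.
Local Open Scope ring_scope.

Definition involutive_antiautomorphism (R : nzRingType) (star : R -> R) : Prop :=
  [/\ {morph star : x y / x + y >-> x + y},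
      {morph star : x y / x * y >-> y * x}
    & involutive star].

Definition ctrmx (R : nzRingType) (star : R -> R) (m n : nat)
  (A : 'M[R]_(m, n)) : 'M[R]_(n, m) := map_mx star A^T.

Definition star_hermitian (R : nzRingType) (star : R -> R) (n : nat)
  (X : 'M[R]_n) : Prop := X = ctrmx star X.

(* MathComp's [\rank] and [vectType] subspaces require commutative scalars.
   Since vectors are rows and scalars act on the left, [u *m A] is the left
   linear combination of the rows of [A] with coefficients [u]. *)
Definition left_row_space (R : nzRingType) (m n : nat) (A : 'M[R]_(m, n)) :
  set 'rV[R]_n := [set v | exists u : 'rV[R]_m, v = u *m A]%classic.

Definition left_independent_rows (R : nzRingType) (r n : nat)
  (B : 'M[R]_(r, n)) : Prop := forall u : 'rV[R]_r, u *m B = 0 -> u = 0.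

Definition is_row_space_basis (R : nzRingType) (m n r : nat)
  (A : 'M[R]_(m, n)) (B : 'M[R]_(r, n)) : Prop :=
  left_independent_rows B /\ left_row_space B = left_row_space A.

(* The size of a basis of the left row space. Over a division ring a basis
   exists and its size is unique, so that neither the choice made by [xget]
   nor its default value [0] matters. *)
Definition dvrank (R : nzRingType) (m n : nat) (A : 'M[R]_(m, n)) : nat :=
  xget 0%N
    [set r | exists B : 'M[R]_(r, n), is_row_space_basis A B]%classic.

Notation "A ||| B" := (row_mx A B)
  (at level 60, right associativity, format "A  |||  B") : ring_scope.
Notation "A /// B" := (col_mx A B)
  (at level 65, right associativity, format "A  ///  '/' B") : ring_scope.

(* Main.v *)
Require Import Defs.
From mathcomp Require Import all_boot all_order all_algebra.
From mathcomp Require Import boolp classical_sets.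

Set Implicit Arguments.
Unset Strict Implicit.
Unset Printing Implicit Defensive.

Import GRing.Theory.
Local Open Scope ring_scope.

(** Every rank equality says that a form vanishes on a product of kernels: a
    block matrix [0, L; R, M] has rank [r(L) + r(R)] iff [x M y = 0] whenever
    [x R = 0] and [L y = 0].  Each of these conditions expresses that [Phi],
    [Psi], [Omega] prescribe the same values of the sesquilinear form [X]
    wherever they overlap, so a solution satisfies them.

    Conversely, pick a Hermitian [X0] with [C X0 C* = Psi], [D X0 D* = Omega]
    and set [dlt = Phi - A X0 A*].  What may be added to [X0] without
    disturbing the last two equations is
    [Kc h1 Kd* + Kd h2 Kc* + Ke h3 + h4 Ke*], with [Kc], [Kd], [Ke] right
    kernels of [C], [D] and [C] stacked on [D].  First [Y] is chosen so that
    [dlt - B Y B*] vanishes on the products of left kernels of [A], [A Kc],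
    [A Kd], [A Ke] on which every [A (...) A*] vanishes; then two equations
    of Sylvester type give [h1, ..., h4].  Averaging [X] with [X*] makes it
    Hermitian. *)

(** One-sided inverses of the two factors stand in for independence of columns and rows. This form
    is symmetric in rows and columns, whereas [dvrank] mentions only left row spaces, and it turns
    rank arguments into matrix identities. *)
Definition full_rank_factorization (R : nzRingType) (m n r : nat)
    (A : 'M[R]_(m, n)) : Prop :=
  exists (L : 'M_(m, r)) (L' : 'M_(r, m)) (B : 'M_(r, n)) (B' : 'M_(n, r)),
    [/\ A = L *m B, L' *m L = 1%:M & B *m B' = 1%:M].

(** * Rank over a division ring *)

Section DivisionRing.
Context (F : unitRingType) (F_division : GRing.field_axiom F).

(** The residue [a'] of the new row modulo the row space of [B] decides: if it vanishes, the rank is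
    unchanged; otherwise it has an invertible entry and joins [B] as one more independent row. *)
Lemma full_rank_factorization_col_mx (m n r : nat) (a : 'rV[F]_n)
    (A1 : 'M_(m, n)) : full_rank_factorization r A1 ->
  exists r', full_rank_factorization r' (col_mx a A1).
Proof.
move=> [L [L' [B [B' [defA1 L'L BB']]]]].
pose a' := a - a *m B' *m B.
have a'B' : a' *m B' = 0.
  by rewrite mulmxBl -!mulmxA BB' mulmx1 subrr.
have defa : a = a' + a *m B' *m B by rewrite subrK.
have [a'0|[j nz_a'j]] : a' = 0 \/ exists j, a' 0 j != 0.
  have [|no] := pselect (exists j, a' 0 j != 0); first by right.
  left; apply/matrixP => i j; rewrite ord1 [RHS]mxE; apply/eqP.
  by apply: contra_notT no => nz; exists j.
- exists r, (col_mx (a *m B') L), (row_mx 0 L'), B, B'; split => //.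
    by rewrite mul_col_mx -defA1 {1}defa a'0 add0r.
  by rewrite mul_row_col mul0mx add0r.
have unit_a'j : a' 0 j \is a GRing.unit by apply: F_division.
pose w0 : 'M[F]_(n, 1) := \col_i (if i == j then (a' 0 j)^-1 else 0).
have a'w0 : a' *m w0 = 1%:M.
  apply/matrixP => i k; rewrite !ord1 mxE [RHS]mxE (bigD1 j) //=.
  rewrite big1 => [|l /negPf ne]; first by rewrite [w0 _ _]mxE !eqxx addr0 divrr.
  by rewrite [w0 _ _]mxE ne mulr0.
pose w := w0 - B' *m (B *m w0).
exists (1 + r)%N, (block_mx 1%:M (a *m B') 0 L).
exists (block_mx 1%:M (- (a *m B' *m L')) 0 L').
exists (col_mx a' B), (row_mx w B'); split.
- rewrite mul_block_col !mul1mx mul0mx add0r -defA1.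
  by rewrite -defa.
- rewrite mulmx_block !mul1mx !mulmx0 !mul0mx mulNmx -!mulmxA L'L mulmx1.
  by rewrite !addr0 subrr add0r -scalar_mx_block.
- rewrite mul_col_row a'B' BB' !mulmxBr a'w0 !mulmxA a'B' BB' mul1mx !mul0mx.
  by rewrite subr0 subrr -scalar_mx_block.
Qed.

Lemma full_rank_factorization_exists (m n : nat) (A : 'M[F]_(m, n)) :
  exists r, full_rank_factorization r A.
Proof.
elim: m A => [|m IHm] A.
  exists 0%N, 0, 0, 0, 0; split; apply/matrixP => -[] //.
have [r Ar] := IHm (dsubmx (A : 'M_(1 + m, n))).
rewrite -[A](vsubmxK (A : 'M_(1 + m, n))).
exact: full_rank_factorization_col_mx Ar.
Qed.

(** Such a [G] makes [1%:M - A *m G] and [1%:M - G *m A] projections onto the left and right kernels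
    of [A]. It is built from the one-sided inverses of the two factors. *)
Lemma ginv_exists (m n : nat) (A : 'M[F]_(m, n)) :
  exists G, A *m G *m A = A.
Proof.
have [r [L [L' [B [B' [-> L'L BB']]]]]] := full_rank_factorization_exists A.
exists (B' *m L').
by rewrite -!mulmxA (mulmxA L') L'L mul1mx (mulmxA B) BB' mul1mx.
Qed.

(** Gaussian elimination of one column. With pivot row [i], the rows of [E *m A] are the other rows
    of [A] cleared of their first entry; [E *m J^T = 1%:M] keeps [u *m E] nonzero. *)
Lemma left_kernel_nontrivial (m n : nat) (A : 'M[F]_(m, n)) :
  (n < m)%N -> exists2 u : 'rV_m, u != 0 & u *m A = 0.
Proof.
elim: n m A => [|n IHn] [|m] A //.
  move=> _; exists (const_mx 1); last exact: thinmx0.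
  by apply/eqP => /matrixP/(_ 0 0); rewrite !mxE; apply/eqP/oner_neq0.
rewrite ltnS => lt_nm; rewrite -[A](hsubmxK (A : 'M_(m.+1, 1 + n))).
move: (lsubmx _) (rsubmx _) => c A1.
change (exists2 u : 'rV_m.+1, u != 0 & u *m (row_mx c A1) = 0 :> 'rV_(1 + n)).
have [c0|[i nz_ci]] : c = 0 \/ exists i, c i 0 != 0.
  have [|no] := pselect (exists i, c i 0 != 0); first by right.
  left; apply/matrixP => i j; rewrite ord1 [RHS]mxE; apply/eqP.
  by apply: contra_notT no => nz; exists i.
- have [u nz_u uA1] := IHn _ A1 (ltnW lt_nm).
  by exists u => //; rewrite mul_mx_row c0 mulmx0 uA1 row_mx0.
pose J : 'M[F]_(m, m.+1) := row' i 1%:M.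
pose d : 'M[F]_(1, m.+1) := row i 1%:M.
pose E := J - (J *m c) *m ((c i 0)^-1%:M *m d).
have JJ : J *m J^T = 1%:M.
  apply/matrixP => k l; rewrite !mxE (bigD1 (lift i k)) //= big1 => [|h ne].
    by rewrite !mxE eqxx mul1r addr0 (inj_eq lift_inj) eq_sym.
  by rewrite !mxE eq_sym (negPf ne) mul0r.
have dJ : d *m J^T = 0.
  apply/matrixP => k l; rewrite !mxE (bigD1 i) //= big1 => [|h ne].
    by rewrite !mxE eq_sym (negPf (neq_lift _ _)) mulr0 addr0.
  by rewrite !mxE eq_sym (negPf ne) mul0r.
have EJ : E *m J^T = 1%:M by rewrite mulmxBl -!mulmxA dJ !mulmx0 subr0.
have Ec : E *m c = 0.
  have dc : d *m c = (c i 0)%:M.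
    by rewrite -row_mul mul1mx; apply/matrixP => k l; rewrite !ord1 !mxE eqxx.
  rewrite mulmxBl -!mulmxA dc -scalar_mxM mulVr ?F_division //.
  by rewrite mulmx1 subrr.
have [u nz_u uEA1] := IHn _ (E *m A1) lt_nm.
exists (u *m E); last first.
  by rewrite mul_mx_row -!mulmxA Ec mulmx0 uEA1 row_mx0.
by apply: contraNneq nz_u => uE0; rewrite -[u]mulmx1 -EJ mulmxA uE0 mul0mx.
Qed.

Lemma mulmx1_leq (m n : nat) (S : 'M[F]_(m, n)) (T : 'M_(n, m)) :
  S *m T = 1%:M -> (m <= n)%N.
Proof.
move=> ST1; case: leqP => // /(left_kernel_nontrivial S)[u /eqP nz_u uS].
by case: nz_u; rewrite -[u]mulmx1 -ST1 mulmxA uS mul0mx.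
Qed.

Lemma left_row_space_sub (m n r : nat) (A : 'M[F]_(m, n)) (B : 'M_(r, n)) :
  (left_row_space A `<=` left_row_space B)%classic -> exists S, A = S *m B.
Proof.
move=> sAB; suff /choice[f Hf]: forall i, exists u : 'rV_r, row i A = u *m B.
  exists (\matrix_i f i); apply/row_matrixP => i.
  by rewrite row_mul rowK.
by move=> i; apply: sAB; exists (delta_mx 0 i); rewrite rowE.
Qed.

Lemma row_space_basis_size (m n r1 r2 : nat) (A : 'M[F]_(m, n))
    (B1 : 'M_(r1, n)) (B2 : 'M_(r2, n)) :
  is_row_space_basis A B1 -> is_row_space_basis A B2 -> (r1 <= r2)%N.
Proof.
move=> [free1 sp1] [free2 sp2].
have [|S defB1] := @left_row_space_sub _ _ _ B1 B2; first by rewrite sp1 sp2.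
have [|T defB2] := @left_row_space_sub _ _ _ B2 B1; first by rewrite sp1 sp2.
apply: (@mulmx1_leq _ _ S T); apply/eqP; rewrite -subr_eq0; apply/eqP.
apply/row_matrixP => i; rewrite row0; apply: free1.
by rewrite -row_mul mulmxBl mul1mx -mulmxA -defB2 -defB1 subrr row0.
Qed.

Lemma dvrank_eq (m n r : nat) (A : 'M[F]_(m, n)) :
  full_rank_factorization r A -> dvrank A = r.
Proof.
move=> [L [L' [B [B' [-> L'L BB']]]]].
have basisB : is_row_space_basis (L *m B) B.
  split=> [u uB|]; first by rewrite -[u]mulmx1 -BB' mulmxA uB mul0mx.
  rewrite predeqE => v; split=> -[u ->]; last by exists (u *m L); rewrite mulmxA.
  by exists (u *m L'); rewrite -mulmxA (mulmxA L') L'L mul1mx.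
(* [xget] may pick another basis, whose size agrees by comparison in both directions; the default
   case is excluded because [B] is a basis. *)
rewrite /dvrank; case: xgetP => [_ -> [B2 basisB2]|/(_ r)[]]; last by exists B.
by apply/eqP; rewrite eqn_leq !(row_space_basis_size basisB2 basisB,
  row_space_basis_size basisB basisB2).
Qed.

Lemma dvrankP (m n : nat) (A : 'M[F]_(m, n)) :
  full_rank_factorization (dvrank A) A.
Proof.
by have [r Ar] := full_rank_factorization_exists A; rewrite (dvrank_eq Ar).
Qed.

(** The identity of size [r'] extracted from a factorization of [P *m A *m Q] factors through size
    [r], because [A] does. *)
Lemma dvrank_mul_le (m m' n n' : nat) (P : 'M[F]_(m', m)) (A : 'M_(m, n))
    (Q : 'M_(n, n')) : (dvrank (P *m A *m Q) <= dvrank A)%N.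
Proof.
have [r Ar] := full_rank_factorization_exists A.
have [r' PAQr'] := full_rank_factorization_exists (P *m A *m Q).
rewrite (dvrank_eq Ar) (dvrank_eq PAQr').
have [L [_ [B [_ [defA _ _]]]]] := Ar.
have [L1 [L1' [B1 [B1' [defPAQ L1K B1K]]]]] := PAQr'.
apply: (mulmx1_leq (S := L1' *m P *m L) (T := B *m Q *m B1')).
have : L1' *m (P *m A *m Q) *m B1' = 1%:M.
  by rewrite defPAQ !mulmxA L1K mul1mx B1K.
by rewrite defA !mulmxA.
Qed.

Lemma dvrank_equiv (m m' n n' : nat) (M : 'M[F]_(m, n)) (N : 'M_(m', n'))
    P Q P' Q' :
  M = P *m N *m Q -> N = P' *m M *m Q' -> dvrank M = dvrank N.
Proof.
move=> defM defN; apply/eqP; rewrite eqn_leq; apply/andP.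
by split; [rewrite defM | rewrite defN]; apply: dvrank_mul_le.
Qed.

Lemma dvrank_eq0 (m n : nat) (A : 'M[F]_(m, n)) : dvrank A = 0%N <-> A = 0.
Proof.
split=> [r0|->].
  have := dvrankP A; rewrite r0 => -[L [_ [B [_ [-> _ _]]]]].
  by rewrite [L]thinmx0 mul0mx.
apply: dvrank_eq; exists 0, 0, 0, 0; split; rewrite ?mulmx0 //;
  by apply/matrixP => -[].
Qed.

Lemma dvrank_col_mxC (m1 m2 n : nat) (A : 'M[F]_(m1, n)) (B : 'M_(m2, n)) :
  dvrank (col_mx A B) = dvrank (col_mx B A).
Proof.
have swap k1 k2 (U : 'M[F]_(k1, n)) (V : 'M_(k2, n)) :
    col_mx U V = block_mx 0 1%:M 1%:M 0 *m col_mx V U *m 1%:M.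
  by rewrite mulmx1 mul_block_col !mul0mx !mul1mx add0r addr0.
exact: dvrank_equiv (swap _ _ A B) (swap _ _ B A).
Qed.

Lemma dvrank_row_mxC (m n1 n2 : nat) (A : 'M[F]_(m, n1)) (B : 'M_(m, n2)) :
  dvrank (row_mx A B) = dvrank (row_mx B A).
Proof.
have swap k1 k2 (U : 'M[F]_(m, k1)) (V : 'M_(m, k2)) :
    row_mx U V = 1%:M *m row_mx V U *m block_mx 0 1%:M 1%:M 0.
  by rewrite mul1mx mul_row_block !mulmx0 !mulmx1 add0r addr0.
exact: dvrank_equiv (swap _ _ A B) (swap _ _ B A).
Qed.

(** [N1] kills the columns of [R] and fixes those of [Z]; [N2] does the same for the rows of [L] and
    [Z]. So the column spaces of [R] and [Z] are independent, as are the row spaces of [L] and [Z],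
    and the three factorizations combine into one. *)
Lemma dvrank_block_anti (m1 m2 n1 n2 : nat) (L : 'M[F]_(m1, n2))
    (R : 'M_(m2, n1)) (Z : 'M_(m2, n2)) (N1 : 'M_m2) (N2 : 'M_n2) :
  N1 *m R = 0 -> L *m N2 = 0 -> N1 *m Z = Z -> Z *m N2 = Z ->
  dvrank (block_mx 0 L R Z) = (dvrank R + (dvrank L + dvrank Z))%N.
Proof.
move=> N1R LN2 N1Z ZN2.
have [L1 [L1' [B1 [B1' [defL L1K B1K]]]]] := dvrankP L.
have [L2 [L2' [B2 [B2' [defR L2K B2K]]]]] := dvrankP R.
have [L3 [L3' [B3 [B3' [defZ L3K B3K]]]]] := dvrankP Z.
have N1L2 : N1 *m L2 = 0.
  by rewrite -[L2]mulmx1 -B2K (mulmxA L2) -defR mulmxA N1R mul0mx.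
have N1L3 : N1 *m L3 = L3.
  by rewrite -[L3]mulmx1 -B3K (mulmxA L3) -defZ mulmxA N1Z.
have B1N2 : B1 *m N2 = 0.
  by rewrite -[B1]mul1mx -L1K -(mulmxA L1') -defL -mulmxA LN2 mulmx0.
have B3N2 : B3 *m N2 = B3.
  by rewrite -[B3]mul1mx -L3K -(mulmxA L3') -defZ -mulmxA ZN2.
apply: dvrank_eq.
exists (block_mx 0 (row_mx L1 0) L2 (row_mx 0 L3)).
exists (col_mx (row_mx 0 (L2' *m (1%:M - N1)))
               (col_mx (row_mx L1' 0) (row_mx 0 (L3' *m N1)))).
exists (col_mx (row_mx B2 0) (col_mx (row_mx 0 B1) (row_mx 0 B3))).
exists (block_mx B2' 0 0 (row_mx ((1%:M - N2) *m B1') (N2 *m B3'))).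
split.
- rewrite !block_mxEv !mul_col_mx !mul_row_col !mul_mx_row.
  by rewrite !mulmx0 !mul0mx !add_row_mx !addr0 !add0r -defL -defR -defZ.
- rewrite block_mxEv !mul_col_mx !mul_row_col !mul_mx_row !mul0mx !mulmx0.
  rewrite !add_row_mx !add0r !addr0 -!mulmxA !mulmxBl !mul1mx N1L2 N1L3.
  rewrite subr0 subrr L1K L2K L3K !mulmx0.
  rewrite row_mx0 -block_mxEv [block_mx 0 _ 0 _]block_mxEh col_mx0.
  by rewrite -!block_mxEv -!scalar_mx_block.
- rewrite block_mxEv !mul_col_mx !mul_row_col !mul_mx_row !mul0mx !mulmx0.
  rewrite !add_row_mx !add0r !addr0 !mulmxA !mulmxBr !mulmx1 B1N2 B3N2.
  rewrite subr0 subrr !mul0mx B1K B2K B3K.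
  rewrite row_mx0 -block_mxEv [block_mx 0 _ 0 _]block_mxEh col_mx0.
  by rewrite -!block_mxEv -!scalar_mx_block.
Qed.

(* Column and row operations replace [M] by its restriction to the left kernel
   of [R] and the right kernel of [L]. *)
Lemma dvrank_block_antitriangular (m1 m2 n1 n2 : nat) (L : 'M[F]_(m1, n2))
    (R : 'M_(m2, n1)) (M : 'M_(m2, n2)) :
  dvrank (block_mx 0 L R M) = (dvrank L + dvrank R)%N <->
  (forall k l (x : 'M_(k, m2)) (y : 'M_(n2, l)),
     x *m R = 0 -> L *m y = 0 -> x *m M *m y = 0).
Proof.
have [GL GLP] := ginv_exists L; have [GR GRP] := ginv_exists R.
pose N1 := 1%:M - R *m GR; pose N2 := 1%:M - GL *m L.
have N1R : N1 *m R = 0 by rewrite mulmxBl mul1mx GRP subrr.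
have LN2 : L *m N2 = 0 by rewrite mulmxBr mulmx1 mulmxA GLP subrr.
pose Z := N1 *m M *m N2.
(* The first summand is cleared by row operations with [L], the second by column operations with
   [R]; only [Z] survives. *)
have defM : N1 *m M *m GL *m L + (R *m (GR *m M) + Z) = M.
  have -> : Z = N1 *m M - N1 *m M *m GL *m L by rewrite /Z mulmxBr mulmx1 !mulmxA.
  rewrite addrC -addrA subrK /N1 mulmxBl mul1mx -mulmxA.
  by rewrite addrC subrK.
have -> : dvrank (block_mx 0 L R M) = dvrank (block_mx 0 L R Z).
  apply: (dvrank_equiv (P := block_mx 1%:M 0 (N1 *m M *m GL) 1%:M)
    (Q := block_mx 1%:M (GR *m M) 0 1%:M)
    (P' := block_mx 1%:M 0 (- (N1 *m M *m GL)) 1%:M)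
    (Q' := block_mx 1%:M (- (GR *m M)) 0 1%:M));
    rewrite !mulmx_block !(mul0mx, mulmx0, mul1mx, mulmx1, addr0, add0r).
    by rewrite addrCA defM.
  by rewrite mulmxN mulNmx -[X in _ + (_ + X)]defM !addKr.
have N1N1 : N1 *m N1 = N1.
  by rewrite {2}/N1 mulmxBr mulmx1 mulmxA N1R mul0mx subr0.
have N2N2 : N2 *m N2 = N2.
  by rewrite {1}/N2 mulmxBl mul1mx -mulmxA LN2 mulmx0 subr0.
rewrite (@dvrank_block_anti _ _ _ _ L R Z N1 N2) //; first last.
- by rewrite /Z -!mulmxA N2N2.
- by rewrite /Z !mulmxA N1N1.
rewrite addnA (addnC (dvrank L)) -[X in _ = X <-> _]addn0.
split=> [/addnI/dvrank_eq0 Z0 k l x y xR Ly|M0].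
  have <- : x *m N1 = x by rewrite mulmxBr mulmx1 mulmxA xR mul0mx subr0.
  have <- : N2 *m y = y by rewrite mulmxBl mul1mx -mulmxA Ly mulmx0 subr0.
  by rewrite !mulmxA -2!(mulmxA x) -/Z Z0 mulmx0 mul0mx.
by congr addn; apply/dvrank_eq0; rewrite /Z; apply: M0.
Qed.

(** The antitriangular criterion for an [L] without rows: its rank is 0 and every [y] lies in its
    right kernel. *)
Lemma dvrank_row_mx_eq (m n1 n2 : nat) (R : 'M[F]_(m, n1)) (M : 'M_(m, n2)) :
  dvrank (row_mx R M) = dvrank R <->
  (forall k (x : 'M_(k, m)), x *m R = 0 -> x *m M = 0).
Proof.
have := @dvrank_block_antitriangular 0 m n1 n2 0 R M.
rewrite block_mxEv row_mx0 col_flat_mx.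
rewrite (_ : dvrank (0 : 'M[F]_(0, n2)) = 0%N); last exact/dvrank_eq0.
rewrite [(0 + dvrank _)%N]add0n => ->; split=> H k.
  by move=> x xR; rewrite -[x *m M]mulmx1; apply: H; rewrite ?mul0mx.
by move=> l x y xR _; rewrite H ?mul0mx.
Qed.

End DivisionRing.

(** * Linear matrix equations *)

Section MatrixEquations.
Context (F : unitRingType) (F_division : GRing.field_axiom F).

(** The rows of [K] span the left kernel and [K] fixes it, so a condition on all kernel vectors can
    be tested on the single matrix [K]. *)
Lemma left_kernel_mx (m n : nat) (A : 'M[F]_(m, n)) :
  exists2 K : 'M_m, K *m A = 0 &
    forall k (x : 'M_(k, m)), x *m A = 0 -> x *m K = x.
Proof.
have [G AGA] := ginv_exists F_division A.
exists (1%:M - A *m G); first by rewrite mulmxBl mul1mx AGA subrr.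
by move=> k x xA; rewrite mulmxBr mulmx1 mulmxA xA mul0mx subr0.
Qed.

Lemma right_kernel_mx (m n : nat) (A : 'M[F]_(m, n)) :
  exists2 K : 'M_n, A *m K = 0 &
    forall k (y : 'M_(n, k)), A *m y = 0 -> K *m y = y.
Proof.
have [G AGA] := ginv_exists F_division A.
exists (1%:M - G *m A); first by rewrite mulmxBr mulmx1 mulmxA AGA subrr.
by move=> k y Ay; rewrite mulmxBl mul1mx -mulmxA Ay mulmx0 subr0.
Qed.

Lemma ginvl (m n k : nat) (A : 'M[F]_(m, n)) (G : 'M_(n, m)) (C : 'M_(m, k)) :
  A *m G *m A = A ->
  (forall l (x : 'M_(l, m)), x *m A = 0 -> x *m C = 0) -> A *m G *m C = C.
Proof.
move=> AGA /(_ _ (1%:M - A *m G)); rewrite !mulmxBl !mul1mx AGA subrr.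
by move/(_ erefl)/eqP; rewrite subr_eq0 => /eqP <-.
Qed.

Lemma ginvr (m n k : nat) (A : 'M[F]_(m, n)) (G : 'M_(n, m)) (C : 'M_(k, n)) :
  A *m G *m A = A ->
  (forall l (y : 'M_(n, l)), A *m y = 0 -> C *m y = 0) -> C *m G *m A = C.
Proof.
move=> AGA /(_ _ (1%:M - G *m A)); rewrite !mulmxBr !mulmx1 !mulmxA AGA subrr.
by move/(_ erefl)/eqP; rewrite subr_eq0 => /eqP <-.
Qed.

(** Start from a solution [X1] of the first equation and add [(1%:M - GA1 *m A1) *m U] and
    [W *m (1%:M - B1 *m GB1)], invisible to it. The second equation becomes
    [a *m U *m B2 + A2 *m W *m d = E]. Its remaining obstruction, the value of [E] on the left
    kernel of [a] and the right kernel of [d], vanishes by the last hypothesis. *)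
Lemma two_equations_solvable (m1 n1 m2 n2 p q : nat)
    (A1 : 'M[F]_(m1, p)) (B1 : 'M_(q, n1)) (C1 : 'M_(m1, n1))
    (A2 : 'M_(m2, p)) (B2 : 'M_(q, n2)) (C2 : 'M_(m2, n2)) :
  (forall k (x : 'M_(k, m1)), x *m A1 = 0 -> x *m C1 = 0) ->
  (forall k (y : 'M_(n1, k)), B1 *m y = 0 -> C1 *m y = 0) ->
  (forall k (x : 'M_(k, m2)), x *m A2 = 0 -> x *m C2 = 0) ->
  (forall k (y : 'M_(n2, k)), B2 *m y = 0 -> C2 *m y = 0) ->
  (forall k l (x1 : 'M_(k, m1)) x2 (y1 : 'M_(n1, l)) y2,
     x1 *m A1 = x2 *m A2 -> B1 *m y1 = B2 *m y2 ->
     x1 *m C1 *m y1 = x2 *m C2 *m y2) ->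
  exists X, A1 *m X *m B1 = C1 /\ A2 *m X *m B2 = C2.
Proof.
move=> A1C1 B1C1 A2C2 B2C2 C12.
have [GA1 A1P] := ginv_exists F_division A1.
have [GB1 B1P] := ginv_exists F_division B1.
have [GA2 A2P] := ginv_exists F_division A2.
have [GB2 B2P] := ginv_exists F_division B2.
pose X1 := GA1 *m C1 *m GB1.
have X1P : A1 *m X1 *m B1 = C1 by rewrite /X1 !mulmxA ginvl // ginvr.
pose a := A2 *m (1%:M - GA1 *m A1); pose d := (1%:M - B1 *m GB1) *m B2.
have [[Ga aP] [Gd dP]] := (ginv_exists F_division a, ginv_exists F_division d).
pose E := C2 - A2 *m X1 *m B2.
have E1 : A2 *m GA2 *m E = E.
  apply: ginvl => // k x xA2.
  by rewrite mulmxBr A2C2 // !mulmxA xA2 !mul0mx subr0.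
have E2 : E *m GB2 *m B2 = E.
  apply: ginvr => // k y B2y.
  by rewrite mulmxBl B2C2 // -!mulmxA B2y !mulmx0 subr0.
pose N := 1%:M - a *m Ga; pose N' := 1%:M - Gd *m d.
have NEN : N *m E *m N' = 0.
  have Na : N *m a = 0 by rewrite mulmxBl mul1mx aP subrr.
  have dN : d *m N' = 0 by rewrite mulmxBr mulmx1 mulmxA dP subrr.
  rewrite /E [N *m _]mulmxBr [(_ - _) *m N']mulmxBl.
  (* [N *m a = 0] says that [N *m A2] is [N *m A2 *m GA1] times [A1], and [d *m N' = 0] is the
     mirror statement; compatibility then applies with [x2 = N] and [y2 = N']. *)
  rewrite -(C12 _ _ (N *m A2 *m GA1) _ (GB1 *m B2 *m N')).
  - by rewrite /X1 !mulmxA subrr.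
  - apply/eqP; rewrite eq_sym -subr_eq0 -!mulmxA -!mulmxBr.
    by rewrite -{1}[A2]mulmx1 -mulmxBr -/a Na.
  - apply/eqP; rewrite eq_sym -subr_eq0 !mulmxA -!mulmxBl.
    by rewrite -{1}[B2]mul1mx -mulmxBl -/d dN.
have A2a : A2 *m GA2 *m a = a by rewrite /a mulmxA A2P.
pose U := Ga *m E *m GB2; pose W := GA2 *m (N *m E) *m Gd.
have expand m n (P : 'M[F]_(m, p)) (Q : 'M_(q, n)) F1 E1' :
    P *m (X1 + F1 *m U + W *m E1') *m Q =
    P *m X1 *m Q + P *m F1 *m U *m Q + P *m W *m (E1' *m Q).
  by rewrite !mulmxDr !mulmxDl !mulmxA.
exists (X1 + (1%:M - GA1 *m A1) *m U + W *m (1%:M - B1 *m GB1)); split.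
  rewrite expand X1P [A1 *m (_ - _)]mulmxBr mulmx1.
  rewrite [A1 *m (GA1 *m _)]mulmxA A1P subrr !mul0mx.
  by rewrite [(_ - _) *m B1]mulmxBl mul1mx B1P subrr mulmx0 !addr0.
rewrite expand -/a -/d -addrA.
have -> : a *m U *m B2 = a *m Ga *m E by rewrite /U -!mulmxA !(mulmxA E) E2.
have -> : A2 *m W *m d = N *m E *m Gd *m d.
  have E3 : A2 *m GA2 *m (N *m E) = N *m E.
    rewrite [N *m E]mulmxBl mul1mx [LHS]mulmxBr E1.
    by rewrite -(mulmxA a) (mulmxA (A2 *m GA2) a) A2a.
  by rewrite /W mulmxA (mulmxA A2) E3.
have -> : N *m E *m Gd *m d = N *m E.
  apply/eqP; rewrite eq_sym -subr_eq0 -!mulmxA.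
  by rewrite -{1}[E]mulmx1 -!mulmxBr -/N' mulmxA NEN.
by rewrite [N *m E]mulmxBl mul1mx [a *m Ga *m E + _]addrC subrK addrC subrK.
Qed.

(** Two equations with one identity coefficient each; their compatibility reduces to
    [C *m B = A *m D]. *)
Lemma left_right_equations_solvable (m n p q : nat)
    (A : 'M[F]_(m, p)) (C : 'M_(m, q)) (B : 'M_(q, n)) (D : 'M_(p, n)) :
  (forall k (x : 'M_(k, m)), x *m A = 0 -> x *m C = 0) ->
  (forall k (y : 'M_(n, k)), B *m y = 0 -> D *m y = 0) ->
  C *m B = A *m D -> exists X, A *m X = C /\ X *m B = D.
Proof.
move=> AC BD CBAD.
have [||||k l x1 x2 y1 y2|X [AX XB]] :=
  @two_equations_solvable _ _ _ _ _ _ A 1%:M C 1%:M B D => //.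
- by move=> k y; rewrite mul1mx => ->; rewrite mulmx0.
- by move=> k x; rewrite mulmx1 => ->; rewrite mul0mx.
- rewrite mulmx1 mul1mx => <- ->.
  by rewrite mulmxA -(mulmxA x1) CBAD !mulmxA.
by exists X; rewrite -{1}AX -XB mulmx1 mul1mx.
Qed.

(** It suffices to split [E] into a summand solvable with [A] and [B] and one solvable with [C] and
    [D]. Kernels turn this into one-sided equations for the first summand: [KA] and [KB] must kill
    it, while [KC] and [KD] must kill its difference from [E]. *)
Lemma sylvester_solvable (m n p1 q1 p2 q2 : nat)
    (A : 'M[F]_(m, p1)) (B : 'M_(q1, n)) (C : 'M_(m, p2)) (D : 'M_(q2, n))
    (E : 'M_(m, n)) :
  (forall k (x : 'M_(k, m)), x *m A = 0 -> x *m C = 0 -> x *m E = 0) ->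
  (forall k (y : 'M_(n, k)), B *m y = 0 -> D *m y = 0 -> E *m y = 0) ->
  (forall k l (x : 'M_(k, m)) (y : 'M_(n, l)),
     x *m A = 0 -> D *m y = 0 -> x *m E *m y = 0) ->
  (forall k l (x : 'M_(k, m)) (y : 'M_(n, l)),
     x *m C = 0 -> B *m y = 0 -> x *m E *m y = 0) ->
  exists X Y, A *m X *m B + C *m Y *m D = E.
Proof.
move=> ACE BDE AED CEB.
have [[KA KA0 KAP] [KC KC0 KCP]] := (left_kernel_mx A, left_kernel_mx C).
have [[KB KB0 KBP] [KD KD0 KDP]] := (right_kernel_mx B, right_kernel_mx D).
have [||| X] := @left_right_equations_solvable _ _ _ _ (col_mx KA KC)
  (col_mx 0 (KC *m E)) (row_mx KB KD) (row_mx 0 (E *m KD)).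
- move=> k x; rewrite -[x]hsubmxK !mul_row_col mulmx0 add0r => /eqP.
  rewrite addr_eq0 => /eqP KAC.
  rewrite mulmxA ACE //; last by rewrite -mulmxA KC0 mulmx0.
  by apply/eqP; rewrite -oppr_eq0 -mulNmx -KAC -mulmxA KA0 mulmx0.
- move=> k y; rewrite -[y]vsubmxK !mul_row_col mul0mx add0r => /eqP.
  rewrite addr_eq0 => /eqP KBD.
  rewrite -mulmxA BDE //; last by rewrite mulmxA KD0 mul0mx.
  by apply/eqP; rewrite -oppr_eq0 -mulmxN -KBD mulmxA KB0 mul0mx.
- by rewrite !mul_col_row !mul0mx !mulmx0 !mulmxA (AED _ _ KA) ?(CEB _ _ KC KB).
rewrite mul_col_mx mul_mx_row => -[/eq_col_mx[KAX KCX] /eq_row_mx[XKB XKD]].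
have [GA AP] := ginv_exists F_division A.
have [GB BP] := ginv_exists F_division B.
have [GC CP] := ginv_exists F_division C.
have [GD DP] := ginv_exists F_division D.
exists (GA *m X *m GB), (GC *m (E - X) *m GD); rewrite !mulmxA.
rewrite (@ginvl _ _ _ A) //; last first.
  by move=> k x xA; rewrite -(KAP _ _ xA) -mulmxA KAX mulmx0.
rewrite (@ginvr _ _ _ B) //; last first.
  by move=> k y By; rewrite -(KBP _ _ By) mulmxA XKB mul0mx.
rewrite (@ginvl _ _ _ C) //; last first.
  by move=> k x xC; rewrite -(KCP _ _ xC) -mulmxA mulmxBr KCX subrr mulmx0.
rewrite (@ginvr _ _ _ D) //; last first.
  by move=> k y Dy; rewrite -(KDP _ _ Dy) mulmxA mulmxBl XKD subrr mul0mx.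
by rewrite addrC subrK.
Qed.

End MatrixEquations.

(** * Conjugate transposition of matrices *)

Section ConjugateTranspose.
Context (F : unitRingType) (star : F -> F).
Context (F_star : involutive_antiautomorphism star).
Local Notation "A ^*" := (ctrmx star A) : ring_scope.

Lemma star0 : star 0 = 0.
Proof.
by case: F_star => starD _ _; apply: (addrI (star 0)); rewrite -starD !addr0.
Qed.

Lemma star1 : star 1 = 1.
Proof.
case: F_star => _ starM starK.
by rewrite -[LHS]mulr1 -{2}[1]starK -starM mulr1 starK.
Qed.

Lemma ctrmxK (m n : nat) (A : 'M[F]_(m, n)) : A^*^* = A.
Proof. by case: F_star => _ _ starK; apply/matrixP => i j; rewrite !mxE starK. Qed.

Lemma ctrmx0 (m n : nat) : (0 : 'M[F]_(m, n))^* = 0.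
Proof. by apply/matrixP => i j; rewrite !mxE star0. Qed.

Lemma ctrmx1 (n : nat) : (1%:M : 'M[F]_n)^* = 1%:M.
Proof.
apply/matrixP => i j; rewrite !mxE eq_sym.
by case: (i == j); rewrite ?star1 ?star0.
Qed.

Lemma ctrmxD (m n : nat) (A B : 'M[F]_(m, n)) : (A + B)^* = A^* + B^*.
Proof. by case: F_star => starD _ _; apply/matrixP => i j; rewrite !mxE starD. Qed.

Lemma ctrmxN (m n : nat) (A : 'M[F]_(m, n)) : (- A)^* = - A^*.
Proof. by apply/eqP; rewrite -addr_eq0 -ctrmxD addNr ctrmx0. Qed.

Lemma ctrmxB (m n : nat) (A B : 'M[F]_(m, n)) : (A - B)^* = A^* - B^*.
Proof. by rewrite ctrmxD ctrmxN. Qed.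

Lemma ctrmxM (m n p : nat) (A : 'M[F]_(m, n)) (B : 'M_(n, p)) :
  (A *m B)^* = B^* *m A^*.
Proof.
case: F_star => starD starM _; apply/matrixP => i j; rewrite !mxE.
rewrite (big_morph star starD star0); apply: eq_bigr => k _.
by rewrite starM !mxE.
Qed.

Lemma ctrmx_col (m1 m2 n : nat) (A : 'M[F]_(m1, n)) (B : 'M_(m2, n)) :
  (col_mx A B)^* = row_mx A^* B^*.
Proof. by rewrite /ctrmx tr_col_mx map_row_mx. Qed.

Lemma ctrmx_row (m n1 n2 : nat) (A : 'M[F]_(m, n1)) (B : 'M_(m, n2)) :
  (row_mx A B)^* = col_mx A^* B^*.
Proof. by rewrite /ctrmx tr_row_mx map_col_mx. Qed.

Lemma ctrmx_eq0 (m n : nat) (A : 'M[F]_(m, n)) : A^* = 0 -> A = 0.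
Proof. by rewrite -{2}[A]ctrmxK => ->; rewrite ctrmx0. Qed.

Lemma ctrmx_mul_eq0 (m n p : nat) (A : 'M[F]_(m, n)) (y : 'M_(m, p)) :
  A^* *m y = 0 -> y^* *m A = 0.
Proof. by move=> Ay; apply: ctrmx_eq0; rewrite ctrmxM ctrmxK. Qed.

Lemma ctrmx_mul_hermitian (m n : nat) (A : 'M[F]_(m, n)) (X : 'M_n) :
  star_hermitian star X -> star_hermitian star (A *m X *m A^*).
Proof. by move=> hX; rewrite /star_hermitian !ctrmxM ctrmxK -hX mulmxA. Qed.

Lemma hermitianD (n : nat) (X Y : 'M[F]_n) :
  star_hermitian star X -> star_hermitian star Y -> star_hermitian star (X + Y).
Proof. by move=> hX hY; rewrite /star_hermitian ctrmxD -hX -hY. Qed.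

Lemma hermitianB (n : nat) (X Y : 'M[F]_n) :
  star_hermitian star X -> star_hermitian star Y -> star_hermitian star (X - Y).
Proof. by move=> hX hY; rewrite /star_hermitian ctrmxB -hX -hY. Qed.

End ConjugateTranspose.

(** * Hermitian solutions when 2 is invertible *)

Section HermitianEquations.
Context (F : unitRingType) (F_division : GRing.field_axiom F).
Context (star : F -> F) (F_star : involutive_antiautomorphism star).
Context (F_char : 2%N \notin [pchar F]).
Local Notation "A ^*" := (ctrmx star A) : ring_scope.
Local Notation hermitian := (star_hermitian star).

Lemma unit2 : (2%:R : F) \is a GRing.unit.
Proof. by apply: F_division; move: F_char; rewrite inE /=. Qed.

Lemma half_mx_exists (m n : nat) (Z : 'M[F]_(m, n)) : exists X, X + X = Z.
Proof.
exists (map_mx ( *%R 2%:R^-1) Z); apply/matrixP => i j; rewrite !mxE.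
by rewrite -mulrDl -mulr2n -[_^-1 *+ 2]mulr_natl divrr ?mul1r ?unit2.
Qed.

Lemma double_mx_inj (m n : nat) (X Y : 'M[F]_(m, n)) : X + X = Y + Y -> X = Y.
Proof.
move=> /matrixP XY; apply/matrixP => i j; apply: (mulrI unit2).
by have := XY i j; rewrite !mxE !mulr_natl !mulr2n.
Qed.

(** [H] is the average of [X] and [X^*]. One [H] serves every [A] at once, so several equations with
    Hermitian right-hand sides survive the averaging together. *)
Lemma hermitian_part (n : nat) (X : 'M[F]_n) : exists2 H : 'M_n, hermitian H &
  forall m (A : 'M_(m, n)), hermitian (A *m X *m A^*) ->
    A *m H *m A^* = A *m X *m A^*.
Proof.
have [H defH] := half_mx_exists (X + X^*); exists H.
  apply: double_mx_inj; rewrite -ctrmxD // defH ctrmxD // ctrmxK //.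
  by rewrite addrC.
move=> m A hAXA; apply: double_mx_inj.
rewrite -mulmxDl -mulmxDr defH mulmxDr mulmxDl; congr (_ + _).
by rewrite hAXA !ctrmxM // ctrmxK // mulmxA.
Qed.

Lemma two_hermitian_equations_solvable (m1 m2 p : nat)
    (A1 : 'M[F]_(m1, p)) (C1 : 'M_m1) (A2 : 'M_(m2, p)) (C2 : 'M_m2) :
  hermitian C1 -> hermitian C2 ->
  (forall k (x : 'M_(k, m1)), x *m A1 = 0 -> x *m C1 = 0) ->
  (forall k (x : 'M_(k, m2)), x *m A2 = 0 -> x *m C2 = 0) ->
  (forall k l (x1 : 'M_(k, m1)) x2 (z1 : 'M_(l, m1)) z2,
     x1 *m A1 = x2 *m A2 -> z1 *m A1 = z2 *m A2 ->
     x1 *m C1 *m z1^* = x2 *m C2 *m z2^*) ->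
  exists X, [/\ hermitian X, A1 *m X *m A1^* = C1 & A2 *m X *m A2^* = C2].
Proof.
move=> hC1 hC2 AC1 AC2 C12.
have right m (A : 'M[F]_(m, p)) (C : 'M_m) : hermitian C ->
    (forall k (x : 'M_(k, m)), x *m A = 0 -> x *m C = 0) ->
    forall k (y : 'M_(m, k)), A^* *m y = 0 -> C *m y = 0.
  move=> hC AC k y /(ctrmx_mul_eq0 F_star) /AC yC.
  by apply: (ctrmx_eq0 F_star); rewrite ctrmxM // -hC.
have [||||k l x1 x2 y1 y2 x12 y12|X [AX1 AX2]] :=
  @two_equations_solvable _ F_division _ _ _ _ _ _ A1 A1^* C1 A2 A2^* C2 => //.
- exact: right.
- exact: right.
- rewrite -[y1](ctrmxK F_star) -[y2](ctrmxK F_star); apply: C12 => //.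
  by rewrite -[A1](ctrmxK F_star) -[A2](ctrmxK F_star) -!ctrmxM // y12.
have [H hH HP] := hermitian_part X.
by exists H; rewrite !HP ?AX1 ?AX2.
Qed.

(* The form [dlt] can be corrected on [S * T] without changing its values on
   [V * V], for row spaces [S <= V <= T] with [dlt] already zero on [S * V]. *)
Lemma staircase_correction (m q s t v : nat) (B : 'M[F]_(m, q)) (dlt : 'M_m)
    (S : 'M_(s, m)) (T : 'M_(t, m)) (V : 'M_(v, m)) (U : 'M_(s, v))
    (W : 'M_(v, t)) :
  S = U *m V -> V = W *m T -> S *m dlt *m V^* = 0 ->
  (forall k (x : 'M_(k, s)), x *m S *m B = 0 -> x *m S *m dlt *m T^* = 0) ->
  (forall k (x : 'M_(k, t)), x *m T *m B = 0 -> S *m dlt *m (x *m T)^* = 0) ->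
  exists Y, [/\ hermitian Y, S *m (dlt - B *m Y *m B^*) *m T^* = 0
    & V *m (B *m Y *m B^*) *m V^* = 0].
Proof.
move=> defS defV SV0 SB TB.
(* This [Y] need not be Hermitian: it reproduces [dlt] on [S * T] and kills [(V *m B)^*]. The
   correction is [Y + Y^*], whose second term contributes nothing on [S * T] since [S] is a multiple
   of [V]. *)
have [|||||Y [SY YV]] := @two_equations_solvable _ F_division _ _ _ _ _ _
  (S *m B) (T *m B)^* (S *m dlt *m T^*) 1%:M (V *m B)^* 0.
- by move=> k x; rewrite !mulmxA => /SB.
- move=> k y /(ctrmx_mul_eq0 F_star); rewrite mulmxA => /TB.
  by rewrite !ctrmxM // ctrmxK // !mulmxA.
- by move=> k x _; rewrite mulmx0.
- by move=> k y _; rewrite mul0mx.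
- move=> k l x1 x2 y1 y2 _ y12; rewrite mulmx0 mul0mx.
  (* Because [V = W *m T], the relation between [y1] and [y2] puts [y1^* - y2^* *m W] in the left
     kernel of [T *m B]. Hence [S *m dlt *m T^* *m y1] equals [S *m dlt *m V^* *m y2], which is
     zero. *)
  have /TB : (y1^* - y2^* *m W) *m T *m B = 0.
    rewrite !mulmxBl -(mulmxA _ W) -defV; apply: (ctrmx_eq0 F_star).
    move: y12; rewrite ctrmxB // !ctrmxM // !ctrmxK // !mulmxA => ->.
    by rewrite subrr.
  rewrite mulmxBl -(mulmxA _ W) -defV ctrmxB // mulmxBr => /eqP.
  rewrite subr_eq0 !ctrmxM // !ctrmxK // !mulmxA => /eqP e.
  by rewrite -!(mulmxA x1) e SV0 mul0mx mulmx0.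
rewrite mul1mx in YV.
have VY : V *m B *m Y^* = 0.
  by rewrite -[V *m B](ctrmxK F_star) -ctrmxM // YV ctrmx0.
exists (Y + Y^*); split.
- by rewrite /star_hermitian ctrmxD // ctrmxK // addrC.
- have S0 : S *m B *m Y^* = 0 by rewrite defS -!(mulmxA U) VY mulmx0.
  rewrite mulmxBr mulmxBl mulmxDr mulmxDl mulmxDr mulmxDl !mulmxA S0 !mul0mx.
  by rewrite addr0 -SY ctrmxM // !mulmxA subrr.
- rewrite mulmxDr mulmxDl mulmxDr mulmxDl !mulmxA VY !mul0mx addr0 -!mulmxA.
  by rewrite -ctrmxM // YV !mulmx0.
Qed.

End HermitianEquations.

(** * Hermitian solvability *)

Section Homogeneous.
Context (F : unitRingType) (F_division : GRing.field_axiom F).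
Context (star : F -> F) (F_star : involutive_antiautomorphism star).
Context (F_char : 2%N \notin [pchar F]).
Local Notation "A ^*" := (ctrmx star A) : ring_scope.
Local Notation hermitian := (star_hermitian star).

(** [P], [Q], [E] will be [A *m KC], [A *m KD], [A *m KE]. The left kernels grow from that of [A]
    through the common kernel of [P] and [Q], then those of [P] and of [Q], to that of [E]; they are
    spanned by [K0], [Kp], [N3], [N4], [N]. [Y] is built in three stages along this chain, each
    preserving what the earlier ones achieved. *)
Lemma homogeneous_system_solvable (m q p p1 p2 p3 : nat) (A : 'M[F]_(m, p))
    (P : 'M_(m, p1)) (Q : 'M_(m, p2)) (E : 'M_(m, p3)) (B : 'M_(m, q))
    (dlt : 'M_m) :
  hermitian dlt ->
  (forall k (x : 'M_(k, m)), x *m A = 0 -> x *m P = 0) ->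
  (forall k (x : 'M_(k, m)), x *m A = 0 -> x *m Q = 0) ->
  (forall k (x : 'M_(k, m)), x *m P = 0 -> x *m E = 0) ->
  (forall k (x : 'M_(k, m)), x *m Q = 0 -> x *m E = 0) ->
  (forall k l (a : 'M_(k, m)) (b : 'M_(l, m)),
     a *m A = 0 -> b *m B = 0 -> a *m dlt *m b^* = 0) ->
  (forall k (a : 'M_(k, m)), a *m A = 0 -> a *m B = 0 -> a *m dlt = 0) ->
  (forall k l (a : 'M_(k, m)) (b : 'M_(l, m)),
     a *m P = 0 -> a *m B = 0 -> b *m P = 0 -> a *m dlt *m b^* = 0) ->
  (forall k l (a : 'M_(k, m)) (b : 'M_(l, m)),
     a *m Q = 0 -> a *m B = 0 -> b *m Q = 0 -> a *m dlt *m b^* = 0) ->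
  (forall k l (a : 'M_(k, m)) (b : 'M_(l, m)),
     a *m P = 0 -> a *m Q = 0 -> b *m E = 0 -> b *m B = 0 ->
     a *m dlt *m b^* = 0) ->
  (forall k l (a : 'M_(k, m)) (b : 'M_(l, m)),
     a *m P = 0 -> a *m Q = 0 -> a *m B = 0 -> b *m E = 0 ->
     a *m dlt *m b^* = 0) ->
  (forall k l (a a' : 'M_(k, m)) (b b' : 'M_(l, m)),
     a *m P = 0 -> a' *m Q = 0 -> a *m B = a' *m B ->
     b *m P = 0 -> b' *m Q = 0 -> b *m B = b' *m B ->
     a *m dlt *m b^* = a' *m dlt *m b'^*) ->
  exists (Y : 'M_q) h1 h2 h3 h4, hermitian Y /\
    P *m h1 *m Q^* + Q *m h2 *m P^* + (E *m h3 *m A^* + A *m h4 *m E^*) +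
    B *m Y *m B^* = dlt.
Proof.
move=> hdlt AP AQ PE QE AB AB0 PB QB PQB PQE PQ.
have [N3 N3P N3K] := left_kernel_mx F_division P.
have [N4 N4Q N4K] := left_kernel_mx F_division Q.
have [Kp KpPQ KpK] := left_kernel_mx F_division (row_mx P Q).
have [N NE NK] := left_kernel_mx F_division E.
have [K0 K0A K0K] := left_kernel_mx F_division A.
have [KpP KpQ] : Kp *m P = 0 /\ Kp *m Q = 0.
  by apply/eq_row_mx; rewrite row_mx0 -mul_mx_row.
have N3N : N3 *m N = N3 by apply/NK/PE.
have N4N : N4 *m N = N4 by apply/NK/QE.
have KpN3 : Kp *m N3 = Kp by apply/N3K.
have KpN4 : Kp *m N4 = Kp by apply/N4K.
have KpN : Kp *m N = Kp by apply/NK/PE.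
have N3N3 : N3 *m N3 = N3 by apply: N3K.
have N4N4 : N4 *m N4 = N4 by apply: N4K.
have NN : N *m N = N by apply/NK.
have K0Kp : K0 *m Kp = K0.
  by apply/KpK; rewrite mul_mx_row AP // AQ // row_mx0.
have K0N : K0 *m N = K0 by rewrite -K0Kp -mulmxA KpN.
have span (X M M' : 'M_m) k l (a : 'M_(k, m)) (b : 'M_(l, m)) :
    M *m X *m M'^* = 0 -> a *m M = a -> b *m M' = b -> a *m X *m b^* = 0.
  move=> MXM <- <-; by rewrite ctrmxM // !mulmxA -!(mulmxA a) MXM mul0mx mulmx0.
have mulBmx (X Y : 'M_m) k l (a : 'M_(k, m)) (b : 'M_(m, l)) :
    a *m (X - Y) *m b = a *m X *m b - a *m Y *m b.
  by rewrite mulmxBr mulmxBl.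
have hBYB Y : hermitian Y -> hermitian (B *m Y *m B^*)
  by exact: ctrmx_mul_hermitian.
(* [Y1] makes the form vanish on [N3 * N3] and [N4 * N4]. *)
have [||k x|k x|k l x1 x2 z1 z2|Y1 [hY1 Y13 Y14]] :=
  @two_hermitian_equations_solvable _ F_division star F_star F_char _ _ _
  (N3 *m B) (N3 *m dlt *m N3^*) (N4 *m B) (N4 *m dlt *m N4^*).
- exact: ctrmx_mul_hermitian.
- exact: ctrmx_mul_hermitian.
- by rewrite !mulmxA => xB; apply: PB => //; rewrite -mulmxA N3P mulmx0.
- by rewrite !mulmxA => xB; apply: QB => //; rewrite -mulmxA N4Q mulmx0.
- rewrite !mulmxA -!(mulmxA _ _ z1^*) -!(mulmxA _ _ z2^*) -!(ctrmxM F_star).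
  move=> x12 z12; apply: PQ => //; by rewrite -mulmxA ?N3P ?N4Q mulmx0.
pose d2 := dlt - B *m Y1 *m B^*.
have hd2 : hermitian d2 by apply: hermitianB => //; apply: hBYB.
have BYBl Y k l (a : 'M_(k, m)) (b : 'M_(m, l)) :
    a *m B = 0 -> a *m (B *m Y *m B^*) *m b = 0.
  by move=> aB; rewrite !mulmxA aB !mul0mx.
have BYBr Y k l (a : 'M_(k, m)) (b : 'M_(l, m)) :
    b *m B = 0 -> a *m (B *m Y *m B^*) *m b^* = 0.
  by move=> bB; rewrite -!mulmxA -ctrmxM // bB ctrmx0 // !mulmx0.
have N3d2 : N3 *m d2 *m N3^* = 0.
  by rewrite mulBmx -Y13 ctrmxM // !mulmxA subrr.
have N4d2 : N4 *m d2 *m N4^* = 0.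
  by rewrite mulBmx -Y14 ctrmxM // !mulmxA subrr.
(* [Y2] makes it vanish on [Kp * N] and changes nothing on [N3 * N3] and [N4 * N4]. The zero needed
   beforehand holds because [Kp] lies in both [N3] and [N4]. *)
have [|||k x xB|k x xB|Y2 [hY2 Y2E Y20]] := @staircase_correction _ F_division
  star F_star _ _ _ _ _ B d2 Kp N (col_mx N3 N4) (row_mx Kp 0) (col_mx N3 N4).
- by rewrite mul_row_col mul0mx addr0 KpN3.
- by rewrite mul_col_mx N3N N4N.
- by rewrite ctrmx_col // mul_mx_row (span _ _ _ _ _ _ _ N3d2 KpN3 N3N3)
    (span _ _ _ _ _ _ _ N4d2 KpN4 N4N4) row_mx0.
- by rewrite mulBmx BYBl // subr0; apply: PQE => //;
    rewrite -mulmxA ?KpP ?KpQ mulmx0.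
- by rewrite mulBmx BYBr // subr0; apply: PQB => //; rewrite -mulmxA NE mulmx0.
have [Y23 Y24] : N3 *m (B *m Y2 *m B^*) *m N3^* = 0 /\
    N4 *m (B *m Y2 *m B^*) *m N4^* = 0.
  move: Y20; rewrite ctrmx_col // !mul_col_mx !mul_mx_row -block_mxEv.
  by rewrite -(block_mx0 F m m m m) => /eq_block_mx[].
pose d3 := d2 - B *m Y2 *m B^*.
have hd3 : hermitian d3 by apply: hermitianB => //; apply: hBYB.
(* [Y3] makes it vanish on [K0] against everything and changes nothing on [N * N], which contains
   the earlier products. *)
have [|||k x xB|k x xB|Y3 [hY3 Y3E Y30]] := @staircase_correction _ F_division
  star F_star _ _ _ _ _ B d3 K0 1%:M N K0 N.
- by [].
- by rewrite mulmx1.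
- exact: span Y2E K0Kp NN.
- rewrite -[_ *m _^*]/(_ *m d3 *m _) !mulBmx !BYBl // !subr0 ctrmx1 // mulmx1.
  by apply: AB0 => //; rewrite -mulmxA K0A mulmx0.
- rewrite mulmx1 in xB *; rewrite !mulBmx !BYBr // !subr0.
  exact: AB.
pose d := d3 - B *m Y3 *m B^*.
have hd : hermitian d by apply: hermitianB => //; apply: hBYB.
have K0d : K0 *m d = 0 by move: Y3E; rewrite ctrmx1 // mulmx1.
have Kpd : Kp *m d *m N^* = 0.
  by rewrite mulBmx Y2E (span _ N N _ _ _ _ Y30) // subr0.
have N3d : N3 *m d *m N3^* = 0.
  by rewrite !mulBmx -mulBmx N3d2 Y23 (span _ N N _ _ _ _ Y30) // !subr0.
have N4d : N4 *m d *m N4^* = 0.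
  by rewrite !mulBmx -mulBmx N4d2 Y24 (span _ N N _ _ _ _ Y30) // !subr0.
(* Restricted to [N * N], the form now meets the four conditions of the first Sylvester equation:
   two come from [Kp * N], the others from [N3 * N3] and [N4 * N4]. *)
have [||||h1 [h2 h12]] := @sylvester_solvable _ F_division _ _ _ _ _ _
  (N *m P) (N *m Q)^* (N *m Q) (N *m P)^* (N *m d *m N^*).
- move=> k x; rewrite !mulmxA => xP xQ.
  by apply: (span d Kp N) => //; apply: KpK; rewrite mul_mx_row xP xQ row_mx0.
- move=> k y /(ctrmx_mul_eq0 F_star) yQ /(ctrmx_mul_eq0 F_star) yP.
  apply: (ctrmx_eq0 F_star); rewrite !ctrmxM // ctrmxK // -hd !mulmxA.
  rewrite !mulmxA in yQ yP.
  by apply: (span d Kp N) => //; apply: KpK; rewrite mul_mx_row yP yQ row_mx0.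
- move=> k l x y xP /(ctrmx_mul_eq0 F_star) yP; rewrite !mulmxA in xP yP *.
  rewrite -[y](ctrmxK F_star) -mulmxA -ctrmxM //.
  by apply: (span d N3 N3) => //; apply: N3K.
- move=> k l x y xQ /(ctrmx_mul_eq0 F_star) yQ; rewrite !mulmxA in xQ yQ *.
  rewrite -[y](ctrmxK F_star) -mulmxA -ctrmxM //.
  by apply: (span d N4 N4) => //; apply: N4K.
pose d' := d - (P *m h1 *m Q^* + Q *m h2 *m P^*).
have Nd' : N *m d' *m N^* = 0.
  rewrite mulBmx [N *m (P *m _ *m _ + _)]mulmxDr.
  rewrite [(_ + _) *m N^*]mulmxDl -h12 !ctrmxM // !mulmxA.
  by rewrite subrr.
have K0d' k (x : 'M_(k, m)) : x *m A = 0 -> x *m d' = 0.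
  move=> xA; rewrite [x *m d']mulmxBr [x *m (P *m _ *m _ + _)]mulmxDr.
  rewrite !mulmxA AP // AQ // !mul0mx addr0 subr0.
  by rewrite -(K0K _ _ xA) -mulmxA K0d mulmx0.
have d'K0 k (y : 'M_(m, k)) : A^* *m y = 0 -> d' *m y = 0.
  move=> /(ctrmx_mul_eq0 F_star) yA.
  rewrite [d' *m y]mulmxBl [(P *m _ *m _ + _) *m y]mulmxDl -!mulmxA.
  rewrite -[y](ctrmxK F_star) -!(ctrmxM F_star) AP // AQ // !ctrmx0 // !mulmx0.
  apply: (ctrmx_eq0 F_star); rewrite addr0 subr0 ctrmxM // ctrmxK // -hd.
  by rewrite -(K0K _ _ yA) -mulmxA K0d mulmx0.
(* The remainder [d'] vanishes on [N * N] and against the left kernel of [A] on both sides, so terms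
   in [E] and [A] absorb it. *)
have [||||h3 [h4 h34]] := @sylvester_solvable _ F_division _ _ _ _ _ _
  E A^* A E^* d'.
- by move=> k x _; apply: K0d'.
- by move=> k y yA _; apply: d'K0.
- move=> k l x y xE /(ctrmx_mul_eq0 F_star) yE; rewrite -[y](ctrmxK F_star).
  by apply: (span d' N N) => //; apply: NK.
- by move=> k l x y /K0d' ->; rewrite mul0mx.
exists (Y1 + Y2 + Y3), h1, h2, h3, h4; split.
  by do 2?apply: hermitianD.
rewrite h34 [_ + d']addrC subrK /d /d3 /d2 !mulmxDr !mulmxDl.
by rewrite [X in _ + X]addrC addrA subrK [X in _ + X]addrC addrA !subrK.
Qed.
End Homogeneous.

(** * Compatibility conditions equivalent to solvability *)

Section Solvability.
Context (F : unitRingType) (F_division : GRing.field_axiom F).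
Context (star : F -> F) (F_star : involutive_antiautomorphism star).
Context (F_char : 2%N \notin [pchar F]).
Local Notation "A ^*" := (ctrmx star A) : ring_scope.
Local Notation hermitian := (star_hermitian star).

(** The left kernel of [K] is exactly the row space of [C]. Thus [a *m (A *m K) = 0] states that
    [a *m A] is a combination of rows of [C], which translates compatibility conditions into kernel
    conditions. *)
Lemma row_space_annihilator (m n : nat) (C : 'M[F]_(m, n)) :
  exists2 K : 'M_n, C *m K = 0 &
    forall k (x : 'M_(k, n)), x *m K = 0 -> exists c, x = c *m C.
Proof.
have [G CGC] := ginv_exists F_division C.
exists (1%:M - G *m C); first by rewrite mulmxBr mulmx1 mulmxA CGC subrr.
move=> k x /eqP; rewrite mulmxBr mulmx1 subr_eq0 mulmxA => /eqP xE.
by exists (x *m G).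
Qed.

Definition compatible_C (s p : nat) (C : 'M[F]_(s, p)) (Psi : 'M_s) :=
  forall k (c : 'M_(k, s)), c *m C = 0 -> c *m Psi = 0.

(** For a solution, [a *m Phi *m a'^*] is a value of the form [X] plus a value of the form [Y]. The
    equation [a *m B = 0] removes the latter, and the former can also be read off from [Psi]. *)
Definition compatible_A_C (m p q s : nat) (A : 'M[F]_(m, p)) (B : 'M_(m, q))
    (C : 'M_(s, p)) (Phi : 'M_m) (Psi : 'M_s) :=
  forall k l (a : 'M_(k, m)) c (a' : 'M_(l, m)) c',
  a *m A = c *m C -> a *m B = 0 -> a' *m A = c' *m C ->
  a *m Phi *m a'^* = c *m Psi *m c'^*.

Section System.
Context (m p q s t : nat).
Context (A : 'M[F]_(m, p)) (B : 'M[F]_(m, q)).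
Context (C : 'M[F]_(s, p)) (D : 'M[F]_(t, p)).
Context (Phi : 'M[F]_m) (Psi : 'M[F]_s) (Omega : 'M[F]_t).
Context (hPhi : hermitian Phi) (hPsi : hermitian Psi).
Context (hOmega : hermitian Omega).

Definition hermitian_solvable := exists (X : 'M[F]_p) (Y : 'M[F]_q),
  [/\ hermitian X, hermitian Y, A *m X *m A^* + B *m Y *m B^* = Phi,
      C *m X *m C^* = Psi & D *m X *m D^* = Omega].

Definition compatible_A_B := forall k l (a : 'M_(k, m)) (b : 'M_(l, m)),
  a *m A = 0 -> b *m B = 0 -> a *m Phi *m b^* = 0.

Definition compatible_AB := forall k (a : 'M_(k, m)),
  a *m A = 0 -> a *m B = 0 -> a *m Phi = 0.

Definition compatible_C_D := forall k l (c : 'M_(k, s)) d (c' : 'M_(l, s)) d',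
  c *m C = d *m D -> c' *m C = d' *m D -> c *m Psi *m c'^* = d *m Omega *m d'^*.

(** Since [a *m A] lies in both row spaces, its pairing with [c' *m C + d' *m D] splits into a value
    known from [Psi] and one known from [Omega]. The form [Y] drops out through the second argument
    here and through the first in [compatible_ABCD_A]. *)
Definition compatible_ACD_AB :=
  forall k l (a : 'M_(k, m)) c d (a' : 'M_(l, m)) c' d',
  a *m A = c *m C -> a *m A = d *m D ->
  a' *m A = c' *m C + d' *m D -> a' *m B = 0 ->
  a *m Phi *m a'^* = c *m Psi *m c'^* + d *m Omega *m d'^*.

Definition compatible_ABCD_A :=
  forall k l (a : 'M_(k, m)) c d (a' : 'M_(l, m)) c' d',
  a *m A = c *m C -> a *m A = d *m D -> a *m B = 0 ->
  a' *m A = c' *m C + d' *m D ->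
  a *m Phi *m a'^* = c *m Psi *m c'^* + d *m Omega *m d'^*.

(* Both sides of the conclusion stand for the value of [B Y B*] at [(a1, b1)],
   which is its value at [(a2, b2)]. *)
Definition compatible_AC_AD :=
  forall k l (a1 a2 : 'M_(k, m)) c d (b1 b2 : 'M_(l, m)) c' d',
  a1 *m A = c *m C -> a2 *m A = d *m D -> a1 *m B = a2 *m B ->
  b1 *m A = c' *m C -> b2 *m A = d' *m D -> b1 *m B = b2 *m B ->
  a1 *m Phi *m b1^* - c *m Psi *m c'^* = a2 *m Phi *m b2^* - d *m Omega *m d'^*.

Lemma hermitian_solvable_compatible : hermitian_solvable ->
  [/\ compatible_A_B, compatible_AB, compatible_C C Psi & compatible_C D Omega] /\
  [/\ compatible_C_D, compatible_A_C A B C Phi Psi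
    & compatible_A_C A B D Phi Omega] /\
  [/\ compatible_ACD_AB, compatible_ABCD_A & compatible_AC_AD].
Proof.
move=> [X [Y [_ _ eqPhi eqPsi eqOmega]]].
have form k l i j r (x : 'M[F]_(k, i)) (Z : 'M_r) (z : 'M_(l, j)) U V :
    x *m (U *m Z *m V^*) *m z^* = (x *m U) *m Z *m (z *m V)^*.
  by rewrite ctrmxM // !mulmxA.
have PhiE k l (a : 'M[F]_(k, m)) (b : 'M_(l, m)) : a *m Phi *m b^* =
    (a *m A) *m X *m (b *m A)^* + (a *m B) *m Y *m (b *m B)^*.
  by rewrite -eqPhi mulmxDr mulmxDl !form.
have PsiE k l (c : 'M[F]_(k, s)) (c' : 'M_(l, s)) :
    c *m Psi *m c'^* = (c *m C) *m X *m (c' *m C)^*.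
  by rewrite -eqPsi form.
have OmegaE k l (d : 'M[F]_(k, t)) (d' : 'M_(l, t)) :
    d *m Omega *m d'^* = (d *m D) *m X *m (d' *m D)^*.
  by rewrite -eqOmega form.
split; [|split]; split.
- by move=> k l a b aA bB; rewrite PhiE aA bB ctrmx0 // !mul0mx mulmx0 addr0.
- by move=> k a aA aB; rewrite -eqPhi mulmxDr !mulmxA aA aB !mul0mx addr0.
- by move=> k c cC; rewrite -eqPsi !mulmxA cC !mul0mx.
- by move=> k d dD; rewrite -eqOmega !mulmxA dD !mul0mx.
- by move=> k l c d c' d' cd cd'; rewrite PsiE OmegaE cd cd'.
- by move=> k l a c a' c' ac aB ac'; rewrite PhiE PsiE ac ac' aB !mul0mx addr0.
- by move=> k l a d a' d' ad aB ad'; rewrite PhiE OmegaE ad ad' aB !mul0mx addr0.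
- move=> k l a c d a' c' d' ac ad acd' aB'.
  rewrite PhiE PsiE OmegaE -ac -ad acd' aB' ctrmx0 // mulmx0 addr0.
  by rewrite ctrmxD // mulmxDr.
- move=> k l a c d a' c' d' ac ad aB acd'.
  rewrite PhiE PsiE OmegaE -ac -ad acd' aB !mul0mx addr0.
  by rewrite ctrmxD // mulmxDr.
- move=> k l a1 a2 c d b1 b2 c' d' a1c a2d aB b1c b2d bB.
  rewrite !PhiE PsiE OmegaE -a1c -a2d -b1c -b2d aB bB.
  by rewrite addrAC subrr add0r addrAC subrr add0r.
Qed.

Lemma compatible_hermitian_solvable :
  [/\ compatible_A_B, compatible_AB, compatible_C C Psi & compatible_C D Omega] ->
  [/\ compatible_C_D, compatible_A_C A B C Phi Psi
    & compatible_A_C A B D Phi Omega] ->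
  [/\ compatible_ACD_AB, compatible_ABCD_A & compatible_AC_AD] ->
  hermitian_solvable.
Proof.
move=> [cA_B cAB cC cD] [cC_D cA_C cA_D] [cACD_AB cABCD_A cAC_AD].
have [X0 [hX0 CX0 DX0]] :=
  two_hermitian_equations_solvable F_division F_star F_char
    hPsi hOmega cC cD cC_D.
have [KC CKC KCP] := row_space_annihilator C.
have [KD DKD KDP] := row_space_annihilator D.
have [KE EKE KEP] := row_space_annihilator (col_mx C D).
have [CKE DKE] : C *m KE = 0 /\ D *m KE = 0.
  by apply/eq_col_mx; rewrite -mul_col_mx EKE col_mx0.
pose dlt := Phi - A *m X0 *m A^*.
have hdlt : hermitian dlt by apply: hermitianB => //; apply: ctrmx_mul_hermitian.
have inC k (a : 'M_(k, m)) : a *m (A *m KC) = 0 -> exists c, a *m A = c *m C.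
  by rewrite mulmxA => /KCP.
have inD k (a : 'M_(k, m)) : a *m (A *m KD) = 0 -> exists d, a *m A = d *m D.
  by rewrite mulmxA => /KDP.
have inE k (a : 'M_(k, m)) :
    a *m (A *m KE) = 0 -> exists c d, a *m A = c *m C + d *m D.
  rewrite mulmxA => /KEP[c ->]; exists (lsubmx c), (rsubmx c).
  by rewrite -mul_row_col hsubmxK.
have form k l i j r (x : 'M[F]_(k, i)) (Z : 'M_r) (z : 'M_(l, j)) U V :
    (x *m U) *m Z *m (z *m V)^* = x *m (U *m Z *m V^*) *m z^*.
  by rewrite ctrmxM // !mulmxA.
have dltE k l (a : 'M_(k, m)) (b : 'M_(l, m)) :
    a *m dlt *m b^* = a *m Phi *m b^* - a *m A *m X0 *m (b *m A)^*.
  by rewrite form mulmxBr mulmxBl.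
have formCD k l (a : 'M_(k, m)) (b : 'M_(l, m)) c d c' d' :
    a *m A = c *m C -> a *m A = d *m D -> b *m A = c' *m C + d' *m D ->
    a *m A *m X0 *m (b *m A)^* = c *m Psi *m c'^* + d *m Omega *m d'^*.
  move=> ac ad ->; rewrite ctrmxD // mulmxDr {1}ac ad !form.
  by rewrite CX0 DX0.
have [||||||||||||Y [h1 [h2 [h3 [h4 [hY eqY]]]]]] :=
  @homogeneous_system_solvable _ F_division star F_star F_char _ _ _ _ _ _
  A (A *m KC) (A *m KD) (A *m KE) B dlt => //.
- by move=> k x xA; rewrite mulmxA xA mul0mx.
- by move=> k x xA; rewrite mulmxA xA mul0mx.
- by move=> k x /inC[c xA]; rewrite mulmxA xA -mulmxA CKE mulmx0.
- by move=> k x /inD[d xA]; rewrite mulmxA xA -mulmxA DKE mulmx0.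
- by move=> k l a b aA bB; rewrite dltE cA_B // aA !mul0mx subr0.
- by move=> k a aA aB; rewrite mulmxBr cAB // !mulmxA aA !mul0mx subr0.
- move=> k l a b /inC[c ac] aB /inC[c' bc].
  by rewrite dltE (cA_C _ _ _ _ _ _ ac aB bc) ac bc form CX0 subrr.
- move=> k l a b /inD[d ad] aB /inD[d' bd].
  by rewrite dltE (cA_D _ _ _ _ _ _ ad aB bd) ad bd form DX0 subrr.
- move=> k l a b /inC[c ac] /inD[d ad] /inE[c' [d' bcd]] bB.
  by rewrite dltE (cACD_AB _ _ _ _ _ _ _ _ ac ad bcd bB)
    (formCD _ _ _ _ _ _ _ _ ac ad bcd) subrr.
- move=> k l a b /inC[c ac] /inD[d ad] aB /inE[c' [d' bcd]].
  by rewrite dltE (cABCD_A _ _ _ _ _ _ _ _ ac ad aB bcd)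
    (formCD _ _ _ _ _ _ _ _ ac ad bcd) subrr.
- move=> k l a1 a2 b1 b2 /inC[c ac] /inD[d ad] aB /inC[c' bc] /inD[d' bd] bB.
  rewrite !dltE ac ad bc bd !form CX0 DX0.
  exact: cAC_AD.
(* Each added term is killed by [C] on the left or by its conjugate transpose on the right, and
   likewise for [D], so the last two equations persist. *)
pose X := X0 + (KC *m h1 *m KD^* + KD *m h2 *m KC^* + (KE *m h3 + h4 *m KE^*)).
have vanish r (U : 'M_(r, p)) : U *m KE = 0 -> U *m KC = 0 \/ U *m KD = 0 ->
    U *m X *m U^* = U *m X0 *m U^*.
  move=> UE U0; have UE' : KE^* *m U^* = 0 by rewrite -ctrmxM // UE ctrmx0.
  rewrite !(mulmxDr U) !mulmxDl !mulmxA UE !mul0mx add0r -!mulmxA UE' !mulmx0.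
  rewrite -!ctrmxM // [X in _ + X](_ : _ = 0) ?addr0 //.
  rewrite !(mulmxA U); case: U0 => ->;
    by rewrite ctrmx0 // !(mul0mx, mulmx0) addr0.
have AXA : A *m X *m A^* + B *m Y *m B^* = Phi.
  rewrite -[RHS](subrK (A *m X0 *m A^*)) -/dlt -eqY /X mulmxDr mulmxDl.
  rewrite [RHS]addrC [RHS]addrA; congr (_ + _ + _).
  by rewrite !mulmxDr !mulmxDl !ctrmxM // !mulmxA.
have [H hH HX] := hermitian_part F_division F_star F_char X.
exists H, Y; split=> //.
- rewrite HX //; rewrite -[A *m X *m A^*](addrK (B *m Y *m B^*)) AXA.
  by apply: hermitianB => //; apply: ctrmx_mul_hermitian.
- by rewrite HX vanish ?CX0 //; left.
- by rewrite HX vanish ?DX0 //; right.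
Qed.

End System.
End Solvability.

(** * The rank equalities *)

Section RankConditions.
Context (F : unitRingType) (F_division : GRing.field_axiom F).

(** [|||] and [///] associate to the right. Regrouping columns or rows to expose a two-by-two block
    shape is a cast, which leaves the rank alone. *)
Lemma dvrank_cols_assoc (m n1 n2 n3 : nat) (M : 'M[F]_(m, n1 + (n2 + n3))) :
  dvrank (castmx (erefl m, addnA n1 n2 n3) M) = dvrank M.
Proof. by case: _ / (addnA n1 n2 n3); rewrite castmx_id. Qed.

Lemma dvrank_rows_assoc (m1 m2 m3 n : nat) (M : 'M[F]_(m1 + (m2 + m3), n)) :
  dvrank (castmx (addnA m1 m2 m3, erefl n) M) = dvrank M.
Proof. by case: _ / (addnA m1 m2 m3); rewrite castmx_id. Qed.

Lemma castmx_row_mxA (m n1 n2 n3 : nat) (M1 : 'M[F]_(m, n1)) (M2 : 'M_(m, n2))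
    (M3 : 'M_(m, n3)) :
  castmx (erefl m, addnA n1 n2 n3) (row_mx M1 (row_mx M2 M3)) =
  row_mx (row_mx M1 M2) M3.
Proof. by rewrite row_mxA castmx_comp castmx_id. Qed.

Lemma castmx_col_mxA (m1 m2 m3 n : nat) (M1 : 'M[F]_(m1, n)) (M2 : 'M_(m2, n))
    (M3 : 'M_(m3, n)) :
  castmx (addnA m1 m2 m3, erefl n) (col_mx M1 (col_mx M2 M3)) =
  col_mx (col_mx M1 M2) M3.
Proof. by rewrite col_mxA castmx_comp castmx_id. Qed.

Lemma castmx_cols_col_mx (m1 m2 n n' : nat) (e : n = n') (M1 : 'M[F]_(m1, n))
    (M2 : 'M_(m2, n)) :
  castmx (erefl (m1 + m2)%N, e) (col_mx M1 M2) =
  col_mx (castmx (erefl m1, e) M1) (castmx (erefl m2, e) M2).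
Proof. by case: _ / e; rewrite !castmx_id. Qed.

Lemma col_row_mx (m1 m2 n1 n2 : nat) (M1 : 'M[F]_(m1, n1)) (M2 : 'M_(m1, n2))
    (M3 : 'M_(m2, n1)) (M4 : 'M_(m2, n2)) :
  col_mx (row_mx M1 M2) (row_mx M3 M4) = row_mx (col_mx M1 M3) (col_mx M2 M4).
Proof. by rewrite -block_mxEv block_mxEh. Qed.

Context (star : F -> F) (F_star : involutive_antiautomorphism star).
Local Notation "A ^*" := (ctrmx star A) : ring_scope.

(** Conjugate transposition exchanges the two factors of a full rank factorization, along with their
    one-sided inverses. *)
Lemma dvrank_ctrmx (m n : nat) (A : 'M[F]_(m, n)) : dvrank A^* = dvrank A.
Proof.
have [r Ar] := full_rank_factorization_exists F_division A.
rewrite (dvrank_eq F_division Ar); apply: (dvrank_eq F_division).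
have [L [L' [B [B' [-> L'L BB']]]]] := Ar.
by exists B^*, B'^*, L^*, L'^*; rewrite -!ctrmxM // L'L BB' ctrmx1.
Qed.

Lemma dvrank_block_ctrmx (m1 m2 n1 n2 : nat) (S : 'M[F]_(n2, m1))
    (R : 'M_(m2, n1)) (M : 'M_(m2, n2)) :
  dvrank (col_mx (row_mx 0 S^*) (row_mx R M)) = (dvrank S + dvrank R)%N <->
  (forall k l (x : 'M_(k, m2)) (z : 'M_(l, n2)),
     x *m R = 0 -> z *m S = 0 -> x *m M *m z^* = 0).
Proof.
rewrite -block_mxEv -(dvrank_ctrmx S).
apply: (iff_trans (dvrank_block_antitriangular F_division _ _ _)).
split=> H k l x z xR zS.
  by apply: H => //; rewrite -ctrmxM // zS ctrmx0.
by rewrite -[z](ctrmxK F_star); apply: H => //; apply: ctrmx_mul_eq0.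
Qed.

Lemma dvrank_block_ctrmxC (m1 m2 n1 n2 : nat) (S : 'M[F]_(n2, m1))
    (R : 'M_(m2, n1)) (M : 'M_(m2, n2)) :
  dvrank (col_mx (row_mx M R) (row_mx S^* 0)) = (dvrank R + dvrank S)%N <->
  (forall k l (x : 'M_(k, m2)) (z : 'M_(l, n2)),
     x *m R = 0 -> z *m S = 0 -> x *m M *m z^* = 0).
Proof.
rewrite dvrank_col_mxC // col_row_mx dvrank_row_mxC // -col_row_mx.
rewrite [(dvrank R + _)%N]addnC.
exact: dvrank_block_ctrmx.
Qed.

Lemma mul_diag2_ctrmx (k l n1 n2 : nat) (M1 : 'M[F]_n1) (M2 : 'M_n2)
    (x1 : 'M_(k, n1)) (x2 : 'M_(k, n2)) (z1 : 'M_(l, n1)) (z2 : 'M_(l, n2)) :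
  row_mx x1 x2 *m (M1 ||| 0 /// 0 ||| M2) *m (row_mx z1 z2)^* =
  x1 *m M1 *m z1^* + x2 *m M2 *m z2^*.
Proof.
by rewrite mul_row_col !mul_mx_row add_row_mx !mulmx0 addr0 add0r ctrmx_row
  mul_row_col.
Qed.

Lemma mul_diag3_ctrmx (k l n1 n2 n3 : nat) (M1 : 'M[F]_n1) (M2 : 'M_n2)
    (M3 : 'M_n3) (x1 : 'M_(k, n1)) (x2 : 'M_(k, n2)) (x3 : 'M_(k, n3))
    (z1 : 'M_(l, n1)) (z2 : 'M_(l, n2)) (z3 : 'M_(l, n3)) :
  row_mx x1 (row_mx x2 x3) *m
    (M1 ||| 0 ||| 0 /// 0 ||| M2 ||| 0 /// 0 ||| 0 ||| M3) *m
    (row_mx z1 (row_mx z2 z3))^* =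
  x1 *m M1 *m z1^* + x2 *m M2 *m z2^* + x3 *m M3 *m z3^*.
Proof.
rewrite !mul_row_col !mul_mx_row !add_row_mx !mulmx0 ?(addr0, add0r).
by rewrite !ctrmx_row !mul_row_col addrA.
Qed.

Lemma row_mxP (k n1 n2 : nat) (x : 'M[F]_(k, n1 + n2)) :
  exists x1 x2, x = row_mx x1 x2.
Proof. by exists (lsubmx x), (rsubmx x); rewrite hsubmxK. Qed.

Lemma row_mx_eq0P (k n1 n2 : nat) (x1 : 'M[F]_(k, n1)) (x2 : 'M_(k, n2)) :
  row_mx x1 x2 = 0 -> x1 = 0 /\ x2 = 0.
Proof. by rewrite -row_mx0 => /eq_row_mx. Qed.

Lemma addr_eq0_mulN (k n1 n2 n : nat) (x : 'M[F]_(k, n1)) (U : 'M_(n1, n))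
    (y : 'M_(k, n2)) (V : 'M_(n2, n)) :
  x *m U + y *m V = 0 -> x *m U = - y *m V.
Proof. by move/eqP; rewrite addr_eq0 mulNmx => /eqP. Qed.

(** After regrouping, [R] is the block matrix of [A], [B], [C] and [S] is [col_mx A C]. Their left
    kernels consist of rows [(a, -c)] with [a *m A = c *m C] and, for [R], also [a *m B = 0]. The
    opposite signs of [Phi] and [Psi] turn vanishing into an equality of values. *)
Lemma rank_A_C (m p q n : nat) (A : 'M[F]_(m, p)) (B : 'M_(m, q))
    (C : 'M_(n, p)) (Phi : 'M_m) (Psi : 'M_n) :
  dvrank (0 ||| 0 ||| A^*   ||| C^* ///
          A ||| B ||| - Phi ||| 0  ///
          C ||| 0 ||| 0     ||| Psi)
    = (dvrank (A ||| B ///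
               C ||| 0) + dvrank (A /// C))%N <->
  compatible_A_C star A B C Phi Psi.
Proof.
rewrite -dvrank_cols_assoc !castmx_cols_col_mx !castmx_row_mxA row_mx0.
rewrite [X in col_mx _ X]col_row_mx -ctrmx_col [(dvrank _ + dvrank _)%N]addnC.
apply: (iff_trans (dvrank_block_ctrmx _ _ _)); split=> H k l.
  move=> a c a' c' ac aB ac'; have := H k l (row_mx a (- c)) (row_mx a' (- c')).
  rewrite mul_diag2_ctrmx !mul_row_col !mul_mx_row add_row_mx !mulmx0 !mulNmx.
  rewrite aB ac ac' !subrr addr0 row_mx0 => /(_ erefl erefl)/eqP.
  rewrite ctrmxN // !(mulmxN, mulNmx, opprK) addrC subr_eq0 eq_sym.
  by move/eqP.
move=> x z; have [a [c ->]] := row_mxP x; have [a' [c' ->]] := row_mxP z.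
rewrite mul_diag2_ctrmx !mul_row_col !mul_mx_row add_row_mx mulmx0 addr0.
move=> /row_mx_eq0P[/addr_eq0_mulN ac aB] /addr_eq0_mulN ac'.
rewrite mulmxN mulNmx (H _ _ _ _ _ _ ac aB ac') ctrmxN //.
by rewrite !(mulmxN, mulNmx, opprK) addNr.
Qed.

Section System.
Context (m p q s t : nat).
Context (A : 'M[F]_(m, p)) (B : 'M[F]_(m, q)).
Context (C : 'M[F]_(s, p)) (D : 'M[F]_(t, p)).
Context (Phi : 'M[F]_m) (Psi : 'M[F]_s) (Omega : 'M[F]_t).

Lemma rank_A_B :
  dvrank (Phi ||| A /// B^* ||| 0) = (dvrank A + dvrank B)%N <->
  compatible_A_B star A B Phi.
Proof. exact: dvrank_block_ctrmxC. Qed.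

Lemma rank_AB :
  dvrank (A ||| B ||| Phi) = dvrank (A ||| B) <-> compatible_AB A B Phi.
Proof.
rewrite -dvrank_cols_assoc castmx_row_mxA.
apply: (iff_trans (dvrank_row_mx_eq F_division _ _)).
split=> H k a.
  by move=> aA aB; apply: H; rewrite mul_mx_row aA aB row_mx0.
by rewrite mul_mx_row => /eqP; rewrite row_mx_eq0 => /andP[/eqP ? /eqP ?]; apply: H.
Qed.

Lemma rank_C_D :
  dvrank (Psi ||| 0        ||| C ///
          0   ||| - Omega  ||| D ///
          C^* ||| D^*      ||| 0) = (2 * dvrank (C /// D))%N <->
  compatible_C_D star C D Psi Omega.
Proof.
rewrite -dvrank_cols_assoc !castmx_cols_col_mx !castmx_row_mxA.
rewrite -dvrank_rows_assoc castmx_col_mxA col_row_mx -ctrmx_col mul2n -addnn.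
apply: (iff_trans (dvrank_block_ctrmxC _ _ _)); split=> H k l.
  move=> c d c' d' cd cd'; have := H k l (row_mx c (- d)) (row_mx c' (- d')).
  rewrite mul_diag2_ctrmx !mul_row_col !mulNmx cd cd' !subrr.
  move=> /(_ erefl erefl)/eqP; rewrite ctrmxN // !(mulmxN, mulNmx, opprK) subr_eq0.
  by move/eqP.
move=> x z; have [c [d ->]] := row_mxP x; have [c' [d' ->]] := row_mxP z.
rewrite mul_diag2_ctrmx !mul_row_col => /addr_eq0_mulN cd /addr_eq0_mulN cd'.
rewrite (H _ _ _ _ _ _ cd cd') ctrmxN //.
by rewrite !(mulmxN, mulNmx, opprK) subrr.
Qed.

(** Rows [(a, -c, -d)] in the left kernel of the second matrix on the right satisfy
    [a *m A = c *m C] and [a *m A = d *m D]; the kernel of the first matrix gives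
    [a' *m A = c' *m C + d' *m D] and [a' *m B = 0]. *)
Lemma rank_ACD_AB :
  dvrank (0 ||| 0 ||| A^*   ||| C^* ||| D^* ///
          0 ||| 0 ||| B^*   ||| 0   ||| 0  ///
          A ||| A ||| - Phi ||| 0   ||| 0  ///
          C ||| 0 ||| 0     ||| Psi ||| 0  ///
          0 ||| D ||| 0     ||| 0   ||| Omega)
    = (dvrank (A ||| B ///
               C ||| 0 ///
               D ||| 0) +
       dvrank (A ||| A ///
               C ||| 0 ///
               0 ||| D))%N <->
  compatible_ACD_AB star A B C D Phi Psi Omega.
Proof.
rewrite -dvrank_cols_assoc !castmx_cols_col_mx !castmx_row_mxA.
rewrite (@row_mx0 _ p p p) (@row_mx0 _ q p p).
rewrite -dvrank_rows_assoc castmx_col_mxA.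
rewrite [X in col_mx X _]col_row_mx col_mx0.
rewrite [X in col_mx _ (col_mx _ X)]col_row_mx [X in col_mx _ X]col_row_mx.
have <- : (A ||| B /// C ||| 0 /// D ||| 0)^* =
    (A^* ||| C^* ||| D^* /// B^* ||| 0 ||| 0).
  rewrite [X in ctrmx _ (col_mx _ X)]col_row_mx col_row_mx ctrmx_row.
  by rewrite !ctrmx_col !ctrmx0.
apply: (iff_trans (dvrank_block_ctrmx _ _ _)); split=> H k l.
  move=> a c d a' c' d' ac ad acd' aB'.
  have := H k l (row_mx a (row_mx (- c) (- d)))
    (row_mx a' (row_mx (- c') (- d'))).
  rewrite mul_diag3_ctrmx !mul_row_col !mul_mx_row !add_row_mx !mulmx0.
  rewrite !(addr0, add0r) !mulNmx -ac -ad acd' aB' -opprD !subrr !row_mx0.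
  move=> /(_ erefl erefl)/eqP.
  rewrite !ctrmxN // !(mulmxN, mulNmx, opprK) -addrA addrC subr_eq0.
  by move/eqP.
move=> x z; have [a [x' ->]] := row_mxP x; have [c [d ->]] := row_mxP x'.
have [a' [z' ->]] := row_mxP z; have [c' [d' ->]] := row_mxP z'.
rewrite mul_diag3_ctrmx !mul_row_col !mul_mx_row !add_row_mx !mulmx0.
rewrite !(addr0, add0r).
move=> /row_mx_eq0P[/addr_eq0_mulN ac /addr_eq0_mulN ad] /row_mx_eq0P[acd' aB'].
have {}acd' : a' *m A = - c' *m C + - d' *m D.
  by apply/eqP; rewrite !mulNmx -opprD -addr_eq0 acd'.
rewrite mulmxN mulNmx (H _ _ _ _ _ _ _ _ ac ad acd' aB') !ctrmxN //.
by rewrite !(mulmxN, mulNmx, opprK) -addrA addNr.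
Qed.

Lemma rank_ABCD_A :
  dvrank (0 ||| 0 ||| 0 ||| A^*   ||| C^*   ||| D^* ///
          A ||| A ||| B ||| - Phi ||| 0   ||| 0  ///
          C ||| 0 ||| 0 ||| 0     ||| Psi ||| 0  ///
          0 ||| D ||| 0 ||| 0     ||| 0   ||| Omega)
    = (dvrank (A ///
               C ///
               D) +
       dvrank (A ||| A ||| B ///
               C ||| 0 ||| 0 ///
               0 ||| D ||| 0))%N <->
  compatible_ABCD_A star A B C D Phi Psi Omega.
Proof.
rewrite -dvrank_cols_assoc !castmx_cols_col_mx !castmx_row_mxA.
rewrite -dvrank_cols_assoc !castmx_cols_col_mx !castmx_row_mxA.
rewrite [X in col_mx _ (col_mx _ X)]col_row_mx [X in col_mx _ X]col_row_mx.
rewrite -[dvrank (A ||| _ /// _)]dvrank_cols_assoc.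
rewrite !castmx_cols_col_mx !castmx_row_mxA -!ctrmx_col.
rewrite (@row_mx0 _ p p p) (@row_mx0 _ p (p + p) q).
apply: (iff_trans (dvrank_block_ctrmx _ _ _)); split=> H k l.
  move=> a c d a' c' d' ac ad aB acd'.
  have := H k l (row_mx a (row_mx (- c) (- d)))
    (row_mx a' (row_mx (- c') (- d'))).
  rewrite mul_diag3_ctrmx !mul_row_col !mul_mx_row !add_row_mx !mulmx0.
  rewrite !(addr0, add0r) !mulNmx -ac -ad aB acd' -opprD !subrr !row_mx0.
  move=> /(_ erefl erefl)/eqP.
  rewrite !ctrmxN // !(mulmxN, mulNmx, opprK) -addrA addrC subr_eq0.
  by move/eqP.
move=> x z; have [a [x' ->]] := row_mxP x; have [c [d ->]] := row_mxP x'.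
have [a' [z' ->]] := row_mxP z; have [c' [d' ->]] := row_mxP z'.
rewrite mul_diag3_ctrmx !mul_row_col !mul_mx_row !add_row_mx !mulmx0.
rewrite !(addr0, add0r).
move=> /row_mx_eq0P[/row_mx_eq0P[/addr_eq0_mulN ac /addr_eq0_mulN ad] aB] acd'.
have {}acd' : a' *m A = - c' *m C + - d' *m D.
  by apply/eqP; rewrite !mulNmx -opprD -addr_eq0 acd'.
rewrite mulmxN mulNmx (H _ _ _ _ _ _ _ _ ac ad aB acd') !ctrmxN //.
by rewrite !(mulmxN, mulNmx, opprK) -addrA addNr.
Qed.

(** The large matrix has blocks [0], [S'^*], [R'], [M]. [S] and [R], which are [S'] and [R'] before
    regrouping, differ by exchanging [C] and [D], yet both have the rank of [T]. *)
Lemma rank_AC_AD :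
  dvrank (0 ||| 0 ||| 0 ||| 0     ||| 0     ||| 0     ||| B^*  ///
          0 ||| 0 ||| 0 ||| D^*   ||| 0     ||| A^*   ||| 0   ///
          0 ||| 0 ||| 0 ||| 0     ||| C^*   ||| A^*   ||| A^*  ///
          0 ||| C ||| 0 ||| 0     ||| - Psi ||| 0     ||| 0   ///
          0 ||| 0 ||| D ||| Omega ||| 0     ||| 0     ||| 0   ///
          0 ||| A ||| A ||| 0     ||| 0     ||| 0     ||| Phi ///
          B ||| 0 ||| A ||| 0     ||| 0     ||| - Phi ||| 0)
    = (2 * dvrank (0 ||| A ||| B ///
                   A ||| A ||| 0 ///
                   C ||| 0 ||| 0 ///
                   0 ||| D ||| 0))%N <->
  compatible_AC_AD star A B C D Phi Psi Omega.
Proof.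
set T := (0 ||| A ||| B /// _ : 'M_(m + (m + (s + t)), p + (p + q))).
pose S := (0 ||| D ||| 0 /// 0 ||| 0 ||| C /// 0 ||| A ||| A /// B ||| 0 ||| A)
  : 'M_(t + (s + (m + m)), q + (p + p)).
pose R := (0 ||| C ||| 0 /// 0 ||| 0 ||| D /// 0 ||| A ||| A /// B ||| 0 ||| A)
  : 'M_(s + (t + (m + m)), q + (p + p)).
have rankR : dvrank R = dvrank T.
  apply: (@dvrank_equiv _ F_division _ _ _ _ _ _
    (0 ||| 0 ||| 1%:M ||| 0 /// 0 ||| 0 ||| 0 ||| 1%:M ///
     0 ||| 1%:M ||| 0 ||| 0 /// 1%:M ||| 0 ||| 0 ||| 0)
    (0 ||| 1%:M ||| 0 /// 0 ||| 0 ||| 1%:M /// 1%:M ||| 0 ||| 0)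
    (0 ||| 0 ||| 0 ||| 1%:M /// 0 ||| 0 ||| 1%:M ||| 0 ///
     1%:M ||| 0 ||| 0 ||| 0 /// 0 ||| 1%:M ||| 0 ||| 0)
    (0 ||| 0 ||| 1%:M /// 1%:M ||| 0 ||| 0 /// 0 ||| 1%:M ||| 0)).
    rewrite /R /T !(mul_col_mx, mul_row_col, mul_mx_row, add_row_mx).
    by rewrite !(mul0mx, mulmx0, mul1mx, mulmx1, addr0, add0r).
  rewrite /R /T !(mul_col_mx, mul_row_col, mul_mx_row, add_row_mx).
  by rewrite !(mul0mx, mulmx0, mul1mx, mulmx1, addr0, add0r).
(* Unlike [R], which is [T] with blocks permuted, [S] also requires subtracting one block row
   containing [A] from the other and changing the sign of the column of [B]. *)
have rankS : dvrank S = dvrank T.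
  apply: (@dvrank_equiv _ F_division _ _ _ _ _ _
    (0 ||| 0 ||| 0 ||| 1%:M /// 0 ||| 0 ||| 1%:M ||| 0 ///
     0 ||| 1%:M ||| 0 ||| 0 /// - 1%:M ||| 1%:M ||| 0 ||| 0)
    (0 ||| 0 ||| 1%:M /// 0 ||| 1%:M ||| 0 /// - 1%:M ||| 0 ||| 0)
    (0 ||| 0 ||| 1%:M ||| - 1%:M /// 0 ||| 0 ||| 1%:M ||| 0 ///
     0 ||| 1%:M ||| 0 ||| 0 /// 1%:M ||| 0 ||| 0 ||| 0)
    (0 ||| 0 ||| - 1%:M /// 0 ||| 1%:M ||| 0 /// 1%:M ||| 0 ||| 0)).
    rewrite /S /T !(mul_col_mx, mul_row_col, mul_mx_row, add_row_mx).
    by rewrite !(mulNmx, mulmxN, mul0mx, mulmx0, mul1mx, mulmx1, oppr0,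
      addr0, add0r, addNr, opprK).
  rewrite /S /T !(mul_col_mx, mul_row_col, mul_mx_row, add_row_mx).
  by rewrite !(mulNmx, mulmxN, mul0mx, mulmx0, mul1mx, mulmx1, oppr0,
    addr0, add0r, subrr, opprK).
rewrite mul2n -addnn -{1}rankS -rankR {rankR rankS}.
pose S' := row_mx (row_mx (0 /// 0 /// 0 /// B) (D /// 0 /// A /// 0))
                  (0 /// C /// A /// A)
  : 'M_(t + (s + (m + m)), q + p + p).
pose R' := row_mx (row_mx (0 /// 0 /// 0 /// B) (C /// 0 /// A /// 0))
                  (0 /// D /// A /// A)
  : 'M_(s + (t + (m + m)), q + p + p).
have -> : dvrank S = dvrank S'.
  rewrite -dvrank_cols_assoc !castmx_cols_col_mx !castmx_row_mxA.
  by rewrite !col_row_mx.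
have -> : dvrank R = dvrank R'.
  rewrite -dvrank_cols_assoc !castmx_cols_col_mx !castmx_row_mxA.
  by rewrite !col_row_mx.
do 2!rewrite -dvrank_cols_assoc !castmx_cols_col_mx !castmx_row_mxA.
do 2!rewrite -dvrank_rows_assoc castmx_col_mxA.
pose M := (0     ||| - Psi ||| 0     ||| 0   ///
           Omega ||| 0     ||| 0     ||| 0   ///
           0     ||| 0     ||| 0     ||| Phi ///
           0     ||| 0     ||| - Phi ||| 0)
  : 'M_(s + (t + (m + m)), t + (s + (m + m))).
have mulM k l (c : 'M_(k, s)) d a b (d' : 'M_(l, t)) c' a' b' :
    row_mx c (row_mx d (row_mx a b)) *m M *m
      (row_mx d' (row_mx c' (row_mx a' b')))^* =
    d *m Omega *m d'^* - c *m Psi *m c'^* +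
    (a *m Phi *m b'^* - b *m Phi *m a'^*).
  rewrite /M !(mul_row_col, mul_mx_row, add_row_mx) !(mulmx0, addr0, add0r).
  by rewrite !ctrmx_row !mul_row_col !(mulmxN, mulNmx) !addrA [RHS]addrAC.
rewrite [X in col_mx X _](_ : _ = row_mx 0 S'^*); last first.
  rewrite (@row_mx0 _ q q p) (@row_mx0 _ q (q + p) p) (@row_mx0 _ p q p).
  rewrite (@row_mx0 _ p (q + p) p) !col_row_mx !col_mx0 /S'.
  by rewrite !ctrmx_row !ctrmx_col !ctrmx0 // !col_row_mx col_mx0.
rewrite [X in col_mx _ X](_ : _ = row_mx R' M); last first.
  by rewrite /R' /M !col_row_mx.
apply: (iff_trans (dvrank_block_ctrmx _ _ _)); split=> H k l.
  move=> a1 a2 c d b1 b2 c' d' a1c a2d aB b1c b2d bB.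
  (* The last blocks are differences so that the column of [B] in [R'] and [S'] encodes
     [a1 *m B = a2 *m B] and [b1 *m B = b2 *m B]. In the value of [M] the mixed term
     [a1 *m Phi *m b2^*] cancels. *)
  have := H k l (row_mx (- c) (row_mx (- d) (row_mx a1 (a2 - a1))))
    (row_mx (- d') (row_mx (- c') (row_mx b2 (b1 - b2)))).
  rewrite mulM /R' /S' !(mul_mx_row, mul_row_col) !mulmx0 !(addr0, add0r).
  have diff k' (x y : 'M[F]_(k', m)) : x *m B = y *m B -> (y - x) *m B = 0.
    by move=> xy; rewrite mulmxBl xy subrr.
  have cancel k' n (u : 'M[F]_(k', n)) U x :
      x *m A = u *m U -> - u *m U + x *m A = 0.
    by move=> xu; rewrite mulNmx xu addNr.
  have add k' (x y : 'M[F]_(k', m)) : x *m A + (y - x) *m A = y *m A.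
    by rewrite mulmxBl addrC subrK.
  rewrite !add !cancel // !diff // !row_mx0 => /(_ erefl erefl)/eqP.
  rewrite !ctrmxN // ctrmxB // mulmxBr !mulmxBl opprB [X in _ + X]addrA subrK.
  rewrite !(mulNmx, mulmxN, opprK) => /eqP e; apply/eqP.
  by rewrite -subr_eq0 -e opprD opprK addrACA addrC [- _ + _]addrC.
move=> x z; have [c [x1 ->]] := row_mxP x; have [d [x2 ->]] := row_mxP x1.
have [a [b ->]] := row_mxP x2; have [d' [z1 ->]] := row_mxP z.
have [c' [z2 ->]] := row_mxP z1; have [a' [b' ->]] := row_mxP z2.
rewrite mulM /R' /S' !(mul_mx_row, mul_row_col) !mulmx0 !(addr0, add0r).
have oppE k' n (u : 'M[F]_(k', n)) U (v : 'M_(k', p)) :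
    u *m U + v = 0 -> v = - u *m U.
  by move/eqP; rewrite addrC addr_eq0 mulNmx => /eqP.
rewrite -!mulmxDl => /row_mx_eq0P[/row_mx_eq0P[bB /oppE ac] /oppE abd].
move=> /row_mx_eq0P[/row_mx_eq0P[bB' /oppE ad'] /oppE abc'].
have := H k l a (a + b) (- c) (- d) (a' + b') a' (- c') (- d').
rewrite !mulmxDl bB bB' !addr0 -!mulmxDl => /(_ ac abd erefl abc' ad' erefl).
rewrite !ctrmxN // ctrmxD // mulmxDr !mulmxDl !(mulNmx, mulmxN, opprK) => /eqP.
rewrite -subr_eq0 opprD opprK addrACA opprD [X in X + _]addrACA subrr add0r.
by rewrite [- _ + _]addrC addrC => /eqP.
Qed.

End System.
End RankConditions.

Theorem theorem3p3 (F : unitRingType) (star : F -> F)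
  (F_division : GRing.field_axiom F)
  (F_star : involutive_antiautomorphism star)
  (F_char : 2%N \notin [pchar F])
  (m p q s t : nat)
  (A : 'M[F]_(m, p)) (B : 'M[F]_(m, q)) (C : 'M[F]_(s, p)) (D : 'M[F]_(t, p))
  (Phi : 'M[F]_m) (Psi : 'M[F]_s) (Omega : 'M[F]_t)
  (hPhi : star_hermitian star Phi) (hPsi : star_hermitian star Psi)
  (hOmega : star_hermitian star Omega) :
  let A' := ctrmx star A in let B' := ctrmx star B in
  let C' := ctrmx star C in let D' := ctrmx star D in
  (exists (X : 'M[F]_p) (Y : 'M[F]_q),
    [/\ star_hermitian star X, star_hermitian star Y,
        A *m X *m A' + B *m Y *m B' = Phi,
        C *m X *m C' = Psi
      & D *m X *m D' = Omega])
  <->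
  dvrank (Phi ||| A ///
          B'  ||| 0) = (dvrank A + dvrank B)%N /\
  dvrank (A ||| B ||| Phi) = dvrank (A ||| B) /\
  dvrank (C ||| Psi) = dvrank C /\
  dvrank (D ||| Omega) = dvrank D /\
  dvrank (Psi ||| 0        ||| C ///
          0   ||| - Omega  ||| D ///
          C'  ||| D'       ||| 0) = (2 * dvrank (C /// D))%N /\
  dvrank (0 ||| 0 ||| A'    ||| C' ///
          A ||| B ||| - Phi ||| 0  ///
          C ||| 0 ||| 0     ||| Psi)
    = (dvrank (A ||| B ///
               C ||| 0) + dvrank (A /// C))%N /\
  dvrank (0 ||| 0 ||| A'    ||| D' ///
          A ||| B ||| - Phi ||| 0  ///
          D ||| 0 ||| 0     ||| Omega)
    = (dvrank (A ||| B ///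
               D ||| 0) + dvrank (A /// D))%N /\
  dvrank (0 ||| 0 ||| A'    ||| C'  ||| D' ///
          0 ||| 0 ||| B'    ||| 0   ||| 0  ///
          A ||| A ||| - Phi ||| 0   ||| 0  ///
          C ||| 0 ||| 0     ||| Psi ||| 0  ///
          0 ||| D ||| 0     ||| 0   ||| Omega)
    = (dvrank (A ||| B ///
               C ||| 0 ///
               D ||| 0) +
       dvrank (A ||| A ///
               C ||| 0 ///
               0 ||| D))%N /\
  dvrank (0 ||| 0 ||| 0 ||| A'    ||| C'  ||| D' ///
          A ||| A ||| B ||| - Phi ||| 0   ||| 0  ///
          C ||| 0 ||| 0 ||| 0     ||| Psi ||| 0  ///
          0 ||| D ||| 0 ||| 0     ||| 0   ||| Omega)
    = (dvrank (A ///
               C ///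
               D) +
       dvrank (A ||| A ||| B ///
               C ||| 0 ||| 0 ///
               0 ||| D ||| 0))%N /\
  dvrank (0 ||| 0 ||| 0 ||| 0     ||| 0     ||| 0     ||| B'  ///
          0 ||| 0 ||| 0 ||| D'    ||| 0     ||| A'    ||| 0   ///
          0 ||| 0 ||| 0 ||| 0     ||| C'    ||| A'    ||| A'  ///
          0 ||| C ||| 0 ||| 0     ||| - Psi ||| 0     ||| 0   ///
          0 ||| 0 ||| D ||| Omega ||| 0     ||| 0     ||| 0   ///
          0 ||| A ||| A ||| 0     ||| 0     ||| 0     ||| Phi ///
          B ||| 0 ||| A ||| 0     ||| 0     ||| - Phi ||| 0)
    = (2 * dvrank (0 ||| A ||| B ///
                   A ||| A ||| 0 ///
                   C ||| 0 ||| 0 ///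
                   0 ||| D ||| 0))%N.
Proof.
move=> A' B' C' D'.
split=> [/(hermitian_solvable_compatible F_star)|].
  move=> [[cA_B cAB cC cD] [[cC_D cA_C cA_D] [cACD_AB cABCD_A cAC_AD]]].
  split; first exact/(rank_A_B F_division F_star).
  split; first exact/(rank_AB F_division).
  split; first exact/(dvrank_row_mx_eq F_division).
  split; first exact/(dvrank_row_mx_eq F_division).
  split; first exact/(rank_C_D F_division F_star).
  split; first exact/(rank_A_C F_division F_star).
  split; first exact/(rank_A_C F_division F_star).
  split; first exact/(rank_ACD_AB F_division F_star).
  split; first exact/(rank_ABCD_A F_division F_star).
  exact/(rank_AC_AD F_division F_star).
move=> [/(rank_A_B F_division F_star) cA_B [/(rank_AB F_division) cAB]].
move=> [/(dvrank_row_mx_eq F_division) cC [/(dvrank_row_mx_eq F_division) cD]].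
move=> [/(rank_C_D F_division F_star) cC_D].
move=> [/(rank_A_C F_division F_star) cA_C].
move=> [/(rank_A_C F_division F_star) cA_D].
move=> [/(rank_ACD_AB F_division F_star) cACD_AB].
move=> [/(rank_ABCD_A F_division F_star) cABCD_A].
move=> /(rank_AC_AD F_division F_star) cAC_AD.
exact: compatible_hermitian_solvable.
Qed.
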